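(* Let $U,V\in\mathfrak{A}$ be such that $U-1$ and $V$ are monotonically independent over $\mathfrak{B}$ with respect to $\Phi$ (in this order: the index of $U-1$ is smaller than the index of $V$). Then, for $z$ in some neighborhood of $0\in\mathfrak{B}$, $$\kappa_{VU}(z)=(\kappa_U\circ\kappa_V)(z),\qquad \rho_{UV}(z)=(\rho_U\circ\rho_V)(z).$$
   Context: $\mathfrak{B}$ is a C$^*$-algebra with norm $\|\cdot\|$, $\mathfrak{A}$ is a $*$-algebra with unit $1$ containing $\mathfrak{B}$ as a subalgebra, and $\Phi:\mathfrak{A}\to\mathfrak{B}$ is a positive conditional expectation, i.e. $\Phi(b_1xb_2+y)=b_1\Phi(x)b_2+\Phi(y)$ for $x,y\in\mathfrak{A}$, $b_1,b_2\in\mathfrak{B}$, $\Phi(b)=b$ for $b\in\mathfrak{B}$, and $\Phi(x^*x)\ge0$ for all $x\in\mathfrak{A}$. $\overline{\mathfrak{A}}$ denotes the closure of $\mathfrak{A}$ in the topology given by $X\mapsto\|\Phi(X^*X)\|$, and the continuous extension of $\Phi$ to $\overline{\mathfrak{A}}$ is also denoted $\Phi$. For $X\in\mathfrak{A}$ and $z$ in a neighborhood of $0\in\mathfrak{B}$ define the $\mathfrak{B}$-valued maps $$\vartheta_X(z)=\Phi\big((1-zX)^{-1}zX\big),\qquad \kappa_X(z)=(1+\vartheta_X(z))^{-1}\vartheta_X(z),$$ $$\varrho_X(z)=\Phi\big(Xz(1-Xz)^{-1}\big),\qquad \rho_X(z)=\varrho_X(z)(1+\varrho_X(z))^{-1},$$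 where $(1-zX)^{-1}=\sum_{n\ge0}(zX)^n$ and $(1-Xz)^{-1}=\sum_{n\ge0}(Xz)^n$. Monotonic independence. A family $\{\mathfrak{A}_j\}_{j\in I}$ of subalgebras of $\mathfrak{A}$ indexed by a totally ordered set $I$ is monotonically independent over $\mathfrak{B}$ (with respect to $\Phi$) if, given $X_j\in\mathfrak{A}_j$ ($j\in I$): (a) for all $i<j>k$ in $I$ and all $A,B\in\mathfrak{A}$, $\Phi(AX_iX_jX_kB)=\Phi(AX_i\Phi(X_j)X_kB)$; (b) for all $i_m>\dots>i_1<k_1<\dots<k_n$ in $I$: $\Phi(X_{i_m}\cdots X_{i_1})=\Phi(X_{i_m})\cdots\Phi(X_{i_1})$, $\Phi(X_{k_1}\cdots X_{k_n})=\Phi(X_{k_1})\cdots\Phi(X_{k_n})$, and $\Phi(X_{i_m}\cdots X_{i_1}X_{k_1}\cdots X_{k_n})=\Phi(X_{i_m})\cdots\Phi(X_{i_1})\Phi(X_{k_1})\cdots\Phi(X_{k_n})$. Elements $\{X_j\}_{j\in I}$ of $\mathfrak{A}$ are monotonically independent over $\mathfrak{B}$ if the subalgebras of $\mathfrak{A}$ generated by $X_j$ and $\mathfrak{B}$ are monotonically independent over $\mathfrak{B}$.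
   Formalization: The series defining the maps need not converge for every element of 𝔄, so it is assumed that Σ(zX)^n converges in the closure for z near 0 when X is U, V, VU (for the κ identity), and Σ(Xz)^n when X is U, V, UV (for the ρ identity). *)

(* Defs.v *)
From HB Require Import structures.
From mathcomp Require Import all_boot all_order all_algebra complex.
From mathcomp Require Import boolp classical_sets reals topology normedtype.
From mathcomp Require Import sequences.

Set Implicit Arguments.
Unset Strict Implicit.
Unset Printing Implicit Defensive.

Import Order.TTheory GRing.Theory Num.Theory.
Import numFieldNormedType.Exports.

Local Open Scope classical_set_scope.
Local Open Scope ring_scope.

(* Unital complex *-algebras: no norm, no topology. *)
HB.mixin Record Algebra_isStarAlgebra (R : realType) (A : Type)
    of GRing.Algebra R[i] A := {
  star : A -> A ;
  starD : forall x y : A, star (x + y) = star x + star y ;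
  starZ : forall (a : R[i]) (x : A), star (a *: x) = (a^*)%C *: star x ;
  starM : forall x y : A, star (x * y) = star y * star x ;
  starK : forall x : A, star (star x) = x
}.

#[short(type="starAlgType")]
HB.structure Definition StarAlgebra (R : realType) :=
  {A of Algebra_isStarAlgebra R A & GRing.Algebra R[i] A}.

#[short(type="starUnitAlgType")]
HB.structure Definition StarUnitAlgebra (R : realType) :=
  {A of StarAlgebra R A & GRing.UnitAlgebra R[i] A}.

(* C*-algebras are taken unital. This is no restriction here: if Phi is a      *)
(* conditional expectation from a unital algebra onto a C*-algebra, then       *)
(* Phi 1 is a unit element of the latter. Requiring the inverse operation of a *)
(* unitAlgType is no restriction either: classically it exists on any ring.    *)
HB.mixin Record StarUnitAlgebra_isPreCStarAlgebra (R : realType) (B : Type)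
    of StarUnitAlgebra R B := {
  cnorm : B -> R[i] ;
  cnormD : forall x y : B, cnorm (x + y) <= cnorm x + cnorm y ;
  cnormZ : forall (a : R[i]) (x : B), cnorm (a *: x) = `|a| * cnorm x ;
  cnorm0_eq0 : forall x : B, cnorm x = 0 -> x = 0 ;
  cnormM : forall x y : B, cnorm (x * y) <= cnorm x * cnorm y ;
  cnorm_cstar : forall x : B, cnorm (star x * x) = cnorm x ^+ 2
}.

#[short(type="preCStarAlgType")]
HB.structure Definition PreCStarAlgebra (R : realType) :=
  {B of StarUnitAlgebra_isPreCStarAlgebra R B & StarUnitAlgebra R B}.

(* The normed space underlying B. This alias is needed because the hierarchy   *)
(* of the library has no room for a type that is both a nzRingType and a       *)
(* normedModType over another ring.                                            *)
Definition nspace (R : realType) (B : preCStarAlgType R) : Type := B.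

HB.instance Definition _ (R : realType) (B : preCStarAlgType R) :=
  GRing.Lmodule.copy (nspace B) B.

HB.instance Definition _ (R : realType) (B : preCStarAlgType R) :=
  Lmodule_isNormed.Build R[i] (nspace B)
    (@cnormD R B) (@cnormZ R B) (@cnorm0_eq0 R B).

HB.mixin Record PreCStarAlgebra_isComplete (R : realType) (B : Type)
    of PreCStarAlgebra R B := {
  cstar_complete : forall F : set_system (nspace B),
    ProperFilter F -> cauchy F -> cvg F
}.

#[short(type="cstarAlgType")]
HB.structure Definition CStarAlgebra (R : realType) :=
  {B of PreCStarAlgebra_isComplete R B & PreCStarAlgebra R B}.

HB.instance Definition _ (R : realType) (B : cstarAlgType R) :=
  Uniform_isComplete.Build (nspace B) (@cstar_complete R B).

(* Note that 0 <= l in R[i] forces l to be real. *)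
Definition cstar_positive (R : realType) (B : cstarAlgType R) (b : B) : Prop :=
  star b = b /\
  forall l : R[i], b - l%:A \isn't a @GRing.unit B -> 0 <= l.

Section OperatorValued.
Context (R : realType) (B : cstarAlgType R) (A : starAlgType R).

(* The inclusion of B in A; the unit of B need not be that of A. *)
Record star_embedding (emb : B -> A) : Prop := StarEmbedding {
  emb_inj : injective emb ;
  embD : forall b c, emb (b + c) = emb b + emb c ;
  embZ : forall (a : R[i]) b, emb (a *: b) = a *: emb b ;
  embM : forall b c, emb (b * c) = emb b * emb c ;
  emb_star : forall b, emb (star b) = star (emb b)
}.

Context (emb : B -> A) (Phi : A -> B).

Record positive_conditional_expectation : Prop := PositiveCondExp {
  condexp_bimod : forall (b1 b2 : B) (x y : A),
    Phi (emb b1 * x * emb b2 + y) = b1 * Phi x * b2 + Phi y ;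
  condexp_id : forall b, Phi (emb b) = b ;
  condexp_pos : forall x, cstar_positive (Phi (star x * x))
}.

(* (Abar, iota) is the (Hausdorff) completion of A for the topology given by   *)
(* X |-> ||Phi (X^* X)||, whose square root is the seminorm making iota         *)
(* isometric, and Phibar is the continuous extension of Phi.                   *)
Record closure_extension (Abar : completeNormedModType R[i])
    (iota : A -> Abar) (Phibar : Abar -> nspace B) : Prop := ClosureExtension {
  iotaD : forall x y, iota (x + y) = iota x + iota y ;
  iotaZ : forall (a : R[i]) x, iota (a *: x) = a *: iota x ;
  iota_norm : forall x, `|iota x| ^+ 2 = cnorm (Phi (star x * x)) ;
  iota_dense : closure (range iota) = [set: Abar] ;
  Phibar_continuous : continuous Phibar ;
  PhibarE : forall x, Phibar (iota x) = Phi x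
}.

(* A single family X_j \in S_j is used throughout: the occurrences of X_i and  *)
(* X_k in the first clause agree when i = k.                                   *)
Definition monotonically_independent (d : Order.disp_t) (I : orderType d)
    (S : I -> set A) : Prop :=
  forall X : I -> A, (forall j, S j (X j)) ->
  (forall i j k : I, (i < j)%O -> (k < j)%O -> forall a b : A,
     Phi (a * X i * X j * X k * b) =
     Phi (a * X i * emb (Phi (X j)) * X k * b)) /\
  (* i :: s = [:: i_1; ...; i_m] and t = [:: k_1; ...; k_n] *)
  (forall (i : I) (s t : seq I), path <%O i s -> path <%O i t ->
   [/\ Phi (\prod_(j <- rev (i :: s)) X j) =
         \prod_(j <- rev (i :: s)) Phi (X j),
       Phi (\prod_(k <- t) X k) = \prod_(k <- t) Phi (X k) &
       Phi ((\prod_(j <- rev (i :: s)) X j) * \prod_(k <- t) X k) =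
         (\prod_(j <- rev (i :: s)) Phi (X j)) * \prod_(k <- t) Phi (X k)]).

(* The subalgebra generated by x over B is the one spanned by the words in x   *)
(* and B in which x occurs; it does not contain B in general. If it did, the   *)
(* case X_i = X_k = 1 (with 1 in B) of monotonic independence would give       *)
(* Phi (a * x * b) = Phi (a * emb (Phi x) * b) for all a, b and all x with a   *)
(* non-minimal index, and independence of U - 1 would be that of U.            *)
Inductive gen_subalgebra (x : A) : set A :=
| gen_base : gen_subalgebra x x
| gen_add u v : gen_subalgebra x u -> gen_subalgebra x v ->
    gen_subalgebra x (u + v)
| gen_scale (a : R[i]) u : gen_subalgebra x u -> gen_subalgebra x (a *: u)
| gen_mul u v : gen_subalgebra x u -> gen_subalgebra x v ->
    gen_subalgebra x (u * v)
| gen_mull b u : gen_subalgebra x u -> gen_subalgebra x (emb b * u)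
| gen_mulr b u : gen_subalgebra x u -> gen_subalgebra x (u * emb b).

Definition monotonically_independent_elements (d : Order.disp_t)
    (I : orderType d) (x : I -> A) : Prop :=
  monotonically_independent (fun j => gen_subalgebra (x j)).

Context (Abar : completeNormedModType R[i]).
Context (iota : A -> Abar) (Phibar : Abar -> nspace B).

(* The series (1 - zX)^-1 (resp. (1 - Xz)^-1) converges in Abar for z near 0;  *)
(* as A carries no completeness this can fail for an arbitrary X.              *)
Definition vartheta_defined (X : A) : Prop :=
  \forall z \near (0 : nspace B),
    cvgn (series (fun n => iota ((emb z * X) ^+ n))).

Definition varrho_defined (X : A) : Prop :=
  \forall z \near (0 : nspace B),
    cvgn (series (fun n => iota ((X * emb z) ^+ n))).

Definition vartheta (X : A) (z : B) : B :=
  Phibar (limn (series (fun n => iota ((emb z * X) ^+ n * (emb z * X))))).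

Definition kappa (X : A) (z : B) : B :=
  (1 + vartheta X z)^-1 * vartheta X z.

Definition varrho (X : A) (z : B) : B :=
  Phibar (limn (series (fun n => iota (X * emb z * (X * emb z) ^+ n)))).

Definition rho (X : A) (z : B) : B :=
  varrho X z * (1 + varrho X z)^-1.

End OperatorValued.

(* Main.v *)
Require Import Defs.
From HB Require Import structures.
From mathcomp Require Import all_boot all_order all_algebra complex.
From mathcomp Require Import separable cyclic cyclotomic.
From mathcomp Require Import boolp classical_sets reals topology normedtype.
From mathcomp Require Import sequences.
From mathcomp Require Import lra ring zify.

Set Implicit Arguments.
Unset Strict Implicit.
Unset Printing Implicit Defensive.

Import Order.TTheory GRing.Theory Num.Theory.
Import numFieldNormedType.Exports.

Local Open Scope classical_set_scope.
Local Open Scope ring_scope.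

(** Write u = U - 1, y_k = (zV)^k, v_k = Phi(y_k) and v = sum_(k >= 1) v_k, so
that v = vartheta_V(z) and w = kappa_V(z) satisfies (1 + v)(1 - w) = 1. Since
kappa_X = (1 + vartheta_X)^-1 vartheta_X, the first identity follows from
  vartheta_(VU)(z) = vartheta_U(w).
Formally, (zVU)^n is split at the occurrences of u: between two of them stands
a block y_k, which independence lets one replace by v_k; what remains is y_k,
y_k x or y_k x y_l with x in the algebra generated by u, and independence
factorizes the expectation. On the other side
(1 - wU)^-1 = (1 - vu)^-1 (1 + v) is the resolvent of the same words with every
block already replaced, so both sides have the same expansion in the degree of
z (moment_product_formula). Monotonic independence is stated for one family of
elements, so that y_k x y_l is only controlled when k = l. By polarization the
error is antisymmetric in (k, l), and the words of a given degree are
symmetric in (k, l): the errors cancel (sum_antisymmetric_triangle).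

Analytically, the moments p_n(z) = Phi((zX)^n) are homogeneous of degree n in
z. The main estimate is a bound |p_n(z)| <= C (L|z|)^n with C and L independent
of z and n (moment_growth_of_bounded), whereas convergence of the series gives
a bound for each z separately. It is obtained from Baire's theorem and the
Cauchy estimates on complex lines, once each p_n is known to be continuous.
Continuity rests on the positivity of Phi: multiplication by an isometry of B
does not increase the seminorm |Phi(x^* x)|^(1/2) beyond that of 1_B x, and
small elements of B are combinations of unitaries, whence b |-> Phi(x b y) is
bounded (condexp_mid_bounded); the uniform boundedness principle then handles
words with several occurrences of z. Given the uniform bound, the formal
identity is evaluated on truncations, which are polynomials in a parameter t
multiplying z, and the Cauchy estimates on |t| = 2 show that the coefficients
beyond the truncation contribute O(2^-K) (moment_sum_composition).

All limits have geometric speed, so they are handled by explicit bounds in the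
real-valued norm nrm. The second identity is the image of the first under the
involution: rho_X(z) is the adjoint of kappa_(X^* )(z^* ), and (U^* - 1, V^* ) is
again a monotone pair. The estimates use convergence only as boundedness
of the moments near 0, a condition stable under the involution, while the
seminorm convergence defining the series is not. *)

(** * The modulus of complex scalars and geometric sums *)

Section Modulus.
Context (R : realType).
Implicit Types a c : R[i].

(** The modulus `|a| is an element of R[i]; its real-valued copy lives in an ordered
field, where estimates can be decided. *)
Definition cmod a : R := complex.Re `|a|.

Lemma cmodE a : `|a| = (cmod a)%:C%C.
Proof. by rewrite RRe_real // ger0_real. Qed.

Lemma cmod_ge0 a : 0 <= cmod a.
Proof. by rewrite -lecR -cmodE normr_ge0. Qed.

Lemma cmod_eq a (x : R) : `|a| = x%:C%C -> cmod a = x.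
Proof. by move=> h; apply: complexI; rewrite -cmodE. Qed.

Lemma cmodM a c : cmod (a * c) = cmod a * cmod c.
Proof. by apply: cmod_eq; rewrite normrM !cmodE -rmorphM. Qed.

Lemma cmodX a n : cmod (a ^+ n) = cmod a ^+ n.
Proof. by apply: cmod_eq; rewrite normrX cmodE -rmorphXn. Qed.

Lemma cmodR (x : R) : 0 <= x -> cmod x%:C%C = x.
Proof. by move=> x0; apply: cmod_eq; rewrite ger0_norm // ler0c. Qed.

Lemma cmod1 : cmod 1 = 1.
Proof. by apply: cmod_eq; rewrite normr1. Qed.

Lemma cmodN1 : cmod (-1) = 1.
Proof. by apply: cmod_eq; rewrite normrN1. Qed.

Lemma cmodi : cmod 'i%C = 1.
Proof. by apply: cmod_eq; rewrite normc_def /= expr0n expr1n add0r sqrtr1. Qed.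

(** X^n - 1 is separable and splits, and n distinct roots of unity in a field
include a primitive one. *)
Lemma primitive_root_complex n : (0 < n)%N -> {w : R[i] | n.-primitive_root w}.
Proof.
move=> n0; have [r hr] := closed_field_poly_normal ('X^n - 1 : {poly R[i]}).
have m1 : 'X^n - 1 \is @monic R[i] by rewrite monicXnsubC.
have {}hr : 'X^n - 1 = \prod_(x <- r) ('X - x%:P).
  by rewrite hr (monicP m1) scale1r.
have ur : uniq r.
  rewrite -separable_prod_XsubC -hr separable_Xn_sub_1 //.
  by rewrite pnatr_eq0 -lt0n.
have sr : size r = n.
  by apply: succn_inj; rewrite -(size_prod_XsubC r id) -hr size_XnsubC.
have rr : all n.-unity_root r.
  by apply/allP => x xr; rewrite /root_of_unity hr root_prod_XsubC.
have := has_prim_root n0 rr ur; rewrite sr leqnn => /(_ isT) /hasP h.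
by have [x _ px] := sig2W h; exists x.
Qed.

Lemma cmod_unity_root n a : (0 < n)%N -> a ^+ n = 1 -> cmod a = 1.
Proof.
move=> n0 h; have : cmod a ^+ n = 1 by rewrite -cmodX h cmod1.
by move/eqP; rewrite pexpr_eq1 ?cmod_ge0 // => /eqP.
Qed.

End Modulus.

Section Geometric.
Context (R : realType).

(** Every limit below is reached at geometric speed; this replaces the
epsilon arguments. *)
Lemma le0_geometric (x C : R) : (forall n, x <= C * 2^-1 ^+ n) -> x <= 0.
Proof.
move=> h; rewrite leNgt; apply/negP => x0.
have C0 : 0 < C by have := h 0%N; rewrite expr0 mulr1; apply: lt_le_trans.
have [n hn] : exists n : nat, C / x < n%:R.
  by exists (Num.truncn (C / x)).+1; rewrite truncnS_gt.
have := h n; apply/negP; rewrite -ltNge exprVn ltr_pdivrMr ?exprn_gt0 //.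
rewrite mulrC -ltr_pdivrMr //; apply: (lt_trans hn).
by rewrite -natrX ltr_nat ltn_expl.
Qed.

Lemma sum_geometric_le (q : R) n m : 0 <= q -> q <= 2^-1 ->
  \sum_(m <= k < n) q ^+ k <= 2 * q ^+ m.
Proof.
move=> q0 q2; have qm : 0 <= q ^+ m by rewrite exprn_ge0.
case: (leqP m n) => [mn|nm]; last by rewrite big_geq ?(ltnW nm) // mulr_ge0.
have [d ->] : exists d, n = (m + d)%N by exists (n - m)%N; rewrite subnKC.
have E : (1 - q) * \sum_(m <= k < m + d) q ^+ k = q ^+ m - q ^+ (m + d).
  rewrite mulr_sumr; under eq_bigr => i _ do rewrite mulrBl mul1r -exprS.
  by rewrite -opprB -(telescope_sumr (fun k => q ^+ k)) ?leq_addr // -sumrN;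
     apply: eq_bigr => i _; rewrite opprB.
have qd : 0 <= q ^+ (m + d) by rewrite exprn_ge0.
have h1 : 2^-1 <= 1 - q by lra.
have s0 : 0 <= \sum_(m <= k < m + d) q ^+ k by apply: sumr_ge0 => i _; rewrite exprn_ge0.
nra.
Qed.

End Geometric.

(** * The real-valued norm and geometric limits in a C*-algebra *)

Section CStarNorm.
Context (R : realType) (B : cstarAlgType R).
Implicit Types (b c x y : B) (a : R[i]).

Definition nrm b : R := complex.Re (cnorm b).

Lemma cnormE b : cnorm b = (nrm b)%:C%C.
Proof.
by rewrite RRe_real // ger0_real // (normr_ge0 (b : nspace B)).
Qed.

Lemma nrm_ge0 b : 0 <= nrm b.
Proof. by rewrite -lecR -cnormE (normr_ge0 (b : nspace B)). Qed.

Lemma nrmD b c : nrm (b + c) <= nrm b + nrm c.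
Proof. by rewrite -lecR rmorphD /= -!cnormE cnormD. Qed.

Lemma nrmZ a b : nrm (a *: b) = cmod a * nrm b.
Proof. by apply: complexI; rewrite rmorphM /= -!cnormE -cmodE cnormZ. Qed.

Lemma nrmM b c : nrm (b * c) <= nrm b * nrm c.
Proof. by rewrite -lecR rmorphM /= -!cnormE cnormM. Qed.

Lemma nrm_cstar b : nrm (star b * b) = nrm b ^+ 2.
Proof. by apply: complexI; rewrite rmorphXn /= -!cnormE cnorm_cstar. Qed.

Lemma nrm_eq0 b : nrm b = 0 -> b = 0.
Proof. by move=> h; apply: cnorm0_eq0; rewrite cnormE h. Qed.

Lemma nrmR (r : R) b : 0 <= r -> nrm (r%:C%C *: b) = r * nrm b.
Proof. by move=> r0; rewrite nrmZ cmodR. Qed.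

Lemma nrm0 : nrm 0 = 0.
Proof. by rewrite -(scale0r (0 : B)) nrmZ (cmod_eq (x := 0)) ?mul0r // normr0. Qed.

Lemma nrmN b : nrm (- b) = nrm b.
Proof. by rewrite -scaleN1r nrmZ cmodN1 mul1r. Qed.

Lemma nrmBC b c : nrm (b - c) = nrm (c - b).
Proof. by rewrite -nrmN opprB. Qed.

Lemma nrmB b c : nrm (b - c) <= nrm b + nrm c.
Proof. by rewrite (le_trans (nrmD _ _)) // nrmN. Qed.

Lemma nrm_triangle c b d : nrm (b - d) <= nrm (b - c) + nrm (c - d).
Proof. by have := nrmD (b - c) (c - d); rewrite addrA subrK. Qed.

Lemma nrm_sum (I : Type) (s : seq I) (P : pred I) (F : I -> B) :
  nrm (\sum_(i <- s | P i) F i) <= \sum_(i <- s | P i) nrm (F i).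
Proof.
elim/big_rec2: _ => [|i r b _ h]; first by rewrite nrm0.
by rewrite (le_trans (nrmD _ _)) // lerD2l.
Qed.

Lemma star0 (A : starAlgType R) : star (0 : A) = 0.
Proof. by apply: (addrI (star (0 : A))); rewrite -starD !addr0. Qed.

Lemma starN (A : starAlgType R) (x : A) : star (- x) = - star x.
Proof. by apply: (addrI (star x)); rewrite -starD !subrr star0. Qed.

Lemma star1 (A : starAlgType R) : star (1 : A) = 1.
Proof.
have : star (star (1 : A) * 1) = star 1 * star (star 1) by rewrite starM.
by rewrite mulr1 starK mulr1.
Qed.

Lemma star_sum (A : starAlgType R) (I : Type) (s : seq I) (P : pred I) (F : I -> A) :
  star (\sum_(i <- s | P i) F i) = \sum_(i <- s | P i) star (F i).
Proof. by elim/big_rec2: _ => [|i x y _ <-]; rewrite ?star0 ?starD. Qed.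

Lemma starX (A : starAlgType R) (x : A) n : star (x ^+ n) = star x ^+ n.
Proof.
by elim: n => [|n IH]; rewrite ?expr0 ?star1 // exprS exprSr starM IH.
Qed.

Lemma nrm_star b : nrm (star b) = nrm b.
Proof.
have h c : nrm c <= nrm (star c).
  have [->|n0] := eqVneq (nrm c) 0; first exact: nrm_ge0.
  have p : 0 < nrm c by rewrite lt_def n0 nrm_ge0.
  by rewrite -(ler_pM2r p) -expr2 -nrm_cstar nrmM.
by apply/eqP; rewrite eq_le h andbT -{2}[b]starK h.
Qed.

Lemma nrm1 : nrm 1 = 1.
Proof.
have e : nrm 1 = nrm 1 ^+ 2 :> R by rewrite -nrm_cstar mulr1 star1.
have n0 : nrm 1 != 0 by apply: contra_neq (oner_neq0 B) => /nrm_eq0.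
by apply: (mulfI n0); rewrite mulr1 -expr2 -e.
Qed.

Lemma nrmX b n : nrm (b ^+ n) <= nrm b ^+ n.
Proof.
elim: n => [|n IH]; first by rewrite !expr0 nrm1.
by rewrite !exprS (le_trans (nrmM _ _)) // ler_wpM2l // nrm_ge0.
Qed.

Lemma eq_geometric x y (C : R) :
  (forall n, nrm (x - y) <= C * 2^-1 ^+ n) -> x = y.
Proof.
move=> /le0_geometric h; apply/eqP; rewrite -subr_eq0; apply/eqP/nrm_eq0.
by apply/eqP; rewrite eq_le h nrm_ge0.
Qed.

Lemma cvg_geometric_limit (u : nat -> B) l (C : R) :
  (forall n, nrm (u n - l) <= C * 2^-1 ^+ n) ->
  (u : nat -> nspace B) @ \oo --> (l : nspace B).
Proof.
move=> h; apply/cvgrPdist_lt => e e0.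
have re : e = (complex.Re e)%:C%C by rewrite RRe_real // gtr0_real.
have r0 : 0 < complex.Re e by rewrite -ltcR -re.
have C0 : 0 <= C by have := le_trans (nrm_ge0 _) (h 0%N); rewrite mulr1.
have [N hN] : exists N : nat, C * 2^-1 ^+ N < complex.Re e.
  apply/not_existsP => hN.
  have : complex.Re e <= 0.
    by apply: (@le0_geometric _ _ C) => n; rewrite leNgt; apply/negP.
  by rewrite leNgt r0.
exists N => // n /= Nn.
have -> : `|(l : nspace B) - (u n : nspace B)| = (nrm (l - u n))%:C%C.
  exact: cnormE.
rewrite re ltcR nrmBC; apply: le_lt_trans (h n) (le_lt_trans _ hN).
by rewrite ler_wpM2l // ler_wiXn2l // ?invr_ge0 ?invf_le1 ?ler0n ?ler1n.
Qed.

Lemma nrm_cvg (u : nat -> B) (l : nspace B) :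
  (u : nat -> nspace B) @ \oo --> l ->
  forall e : R, 0 < e -> exists N, forall n, (N <= n)%N -> nrm (u n - (l : B)) < e.
Proof.
move=> /cvgrPdist_lt h e e0.
have e0' : 0 < e%:C%C by rewrite ltcR.
have [N _ hN] := h _ e0'; exists N => n Nn.
have /= := hN n Nn; rewrite nrmBC.
have -> : `|l - (u n : nspace B)| = (nrm ((l : B) - u n))%:C%C.
  exact: cnormE.
by rewrite ltcR.
Qed.

(** Completeness is only used through this form, which keeps the rate. *)
Lemma complete_geometric (u : nat -> B) (C : R) :
  (forall n, nrm (u n.+1 - u n) <= C * 2^-1 ^+ n) ->
  exists l, forall n, nrm (u n - l) <= 2 * C * 2^-1 ^+ n.
Proof.
move=> h; have C0 : 0 <= C by have := le_trans (nrm_ge0 _) (h 0%N); rewrite mulr1.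
have dist n m : (n <= m)%N -> nrm (u m - u n) <= 2 * C * 2^-1 ^+ n.
  move=> nm; rewrite -(telescope_sumr u nm) (le_trans (nrm_sum _ _ _)) //.
  rewrite (@le_trans _ _ (\sum_(n <= k < m) C * 2^-1 ^+ k)) //.
    by apply: ler_sum => i _; apply: h.
  rewrite -mulr_sumr [2 * C]mulrC -mulrA ler_wpM2l //.
  by rewrite sum_geometric_le // invr_ge0 ler0n.
have cu : cauchy ((u : nat -> nspace B) @ \oo).
  apply: cauchy_exP => e e0.
  have re : e = (complex.Re e)%:C%C by rewrite RRe_real // gtr0_real.
  have r0 : 0 < complex.Re e by rewrite -ltcR -re.
  have [N hN] : exists N : nat, 2 * C * 2^-1 ^+ N < complex.Re e.
    apply/not_existsP => hN.
    have : complex.Re e <= 0.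
      by apply: (@le0_geometric _ _ (2 * C)) => n; rewrite leNgt; apply/negP.
    by rewrite leNgt r0.
  exists (u N), N => // n /= Nn.
  rewrite -ball_normE /ball_ /=.
  have -> : `|(u N : nspace B) - (u n : nspace B)| = (nrm (u N - u n))%:C%C.
    exact: cnormE.
  by rewrite re ltcR nrmBC; apply: le_lt_trans (dist _ _ Nn) hN.
have /cauchy_cvg /cvg_ex [l hl] := cu; exists l => n.
apply/ler_addgt0Pr => e e0.
have [N hN] := nrm_cvg hl e0.
have h1 := hN (maxn N n) (leq_maxl _ _).
have h2 := dist n (maxn N n) (leq_maxr _ _).
apply: le_trans (nrm_triangle (u (maxn N n)) _ _) _.
by rewrite nrmBC lerD // ltW.
Qed.

End CStarNorm.

(** * Baire category, units near 1 and averages of unitaries *)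

Section BanachAlgebra.
Context (R : realType) (B : cstarAlgType R).
Implicit Types (b c x y : B).
Local Notation nrm := (@nrm R B).

(** Baire's theorem for a countable closed cover of B. If no F k contained a
ball, balls of radius at most 2^-k avoiding F k could be nested, and their
common point would escape the cover. *)
Lemma baire_cover (F : nat -> B -> Prop) :
  (forall k x, (forall e, 0 < e -> exists2 y, F k y & nrm (y - x) < e) -> F k x) ->
  (forall x, exists k, F k x) ->
  exists k x (r : R), 0 < r /\ forall y, nrm (y - x) < r -> F k y.
Proof.
move=> Fcl Fcov; apply: contrapT => noball.
have H k x r : 0 < r -> exists2 y, nrm (y - x) < r & ~ F k y.
  move=> r0; apply: contrapT => hy; apply: noball; exists k, x, r; split=> // y yr.
  by apply: contrapT => nF; apply: hy; exists y.
have step (q : nat * (B * R)) : exists p : B * R, 0 < q.2.2 ->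
    [/\ 0 < p.2, p.2 <= q.2.2 / 2, nrm (p.1 - q.2.1) <= q.2.2 / 2 &
        forall y, nrm (y - p.1) <= p.2 -> ~ F q.1 y].
  case: q => k [x r] /=; have [r0|] := ltP 0 r; last by exists (x, r); lra.
  have r20 : 0 < r / 2 by rewrite divr_gt0.
  have [y yr nFy] := H k x (r / 2) r20.
  have [e e0 he] : exists2 e, 0 < e & forall z, nrm (z - y) < e -> ~ F k z.
    apply: contrapT => he; apply: nFy; apply: Fcl => e e0.
    apply: contrapT => hz; apply: he; exists e => // z ze Fz.
    by apply: hz; exists z.
  exists (y, Num.min (r / 2) (e / 2)) => /= _; split.
  - by rewrite lt_min r20 divr_gt0.
  - by rewrite ge_min lexx.
  - exact: ltW.
  - move=> z zs; apply: he; apply: le_lt_trans zs _.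
    by rewrite gt_min; apply/orP; right; lra.
have {step H} [f hf] := choice step.
pose fix ar n := if n is m.+1 then f (m, ar m) else (0 : B, 1 : R).
have r0 n : 0 < (ar n).2.
  by elim: n => [|n IH] //=; have [] := hf (n, ar n) IH.
have hs n := hf (n, ar n) (r0 n).
have rn n : (ar n).2 <= 2^-1 ^+ n.
  elim: n => [|n IH] /=; first by rewrite expr0.
  have [_ h _ _] := hs n; rewrite exprS mulrC; apply: le_trans h _.
  by rewrite ler_wpM2r // invr_ge0.
have cauchy_ar n : nrm ((ar n.+1).1 - (ar n).1) <= 1 * 2^-1 ^+ n.
  have [_ _ h _] := hs n; apply: le_trans h _; have := rn n; have := r0 n.
  by rewrite /=; lra.
have [l hl] := complete_geometric cauchy_ar.
have nest n m : (n <= m)%N -> nrm ((ar m).1 - (ar n).1) + (ar m).2 <= (ar n).2.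
  elim: m => [|m IH]; first by rewrite leqn0 => /eqP->; rewrite subrr nrm0 add0r.
  rewrite leq_eqVlt => /orP[/eqP->|/IH {}IH]; first by rewrite subrr nrm0 add0r.
  have [_ h1 h2 _] := hs m.
  have := nrm_triangle (ar m).1 (ar m.+1).1 (ar n).1.
  rewrite /= in h1 h2 *; lra.
have [k Fk] := Fcov l.
have [_ _ _ /(_ l)] := hs k; apply=> //=.
rewrite -subr_le0; apply: (@le0_geometric _ _ (2 * 1)) => n.
have h1 := hl (n + k.+1)%N.
have h2 := nest k.+1 (n + k.+1)%N (leq_addl _ _).
have h3 := nrm_triangle (ar (n + k.+1)%N).1 l (ar k.+1).1.
have h4 := r0 (n + k.+1)%N.
have h5 : 2^-1 ^+ (n + k.+1) <= 2^-1 ^+ n :> R.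
  by rewrite ler_wiXn2l ?leq_addr // ?invr_ge0 ?invf_le1 ?ler0n ?ler1n.
rewrite nrmBC in h1; rewrite /= in h2 h3 *; lra.
Qed.

(** Neumann series. *)
Lemma unit_near1 x : nrm x <= 2^-1 -> 1 + x \is a GRing.unit.
Proof.
move=> hx; pose y := - x; have hy : nrm y <= 2^-1 by rewrite nrmN.
have yn n : nrm (y ^+ n) <= 2^-1 ^+ n.
  by rewrite (le_trans (nrmX _ _)) // lerXn2r ?nnegrE ?nrm_ge0 // invr_ge0.
pose s n := \sum_(k < n) y ^+ k.
have [l hl] : exists l, forall n, nrm (s n - l) <= 2 * 1 * 2^-1 ^+ n.
  apply: complete_geometric => n.
  by rewrite /s big_ord_recr /= addrAC subrr add0r mul1r.
have E1 n : (1 + x) * s n = 1 - y ^+ n.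
  rewrite -[x]opprK -/y -opprB mulNr -[y - 1]opprB opprB -subrX1 opprB //.
have E2 n : s n * (1 + x) = 1 - y ^+ n.
  have c : GRing.comm (1 + x) (s n).
    apply: commr_sum => i _; apply: commrX; rewrite /y.
    by apply: commr_sym; apply: commrD; [exact: commr1|apply/commr_sym/commrN].
  by rewrite -c E1.
apply/unitrP; exists l; split; apply: (@eq_geometric _ _ _ _ (2 * nrm (1 + x) + 1)) => n.
- rewrite (_ : l * (1 + x) - 1 = (l - s n) * (1 + x) - y ^+ n); last first.
    by rewrite mulrBl E2 opprB -addrA addrAC subrr add0r.
  apply: le_trans (nrmB _ _) _; have := nrmM (l - s n) (1 + x); rewrite nrmBC.
  by have := yn n; have := hl n; have := nrm_ge0 (1 + x); nra.
- rewrite (_ : (1 + x) * l - 1 = (1 + x) * (l - s n) - y ^+ n); last first.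
    by rewrite mulrBr E1 opprB -addrA addrAC subrr add0r.
  apply: le_trans (nrmB _ _) _; have := nrmM (1 + x) (l - s n).
  rewrite [nrm (l - _)]nrmBC.
  by have := yn n; have := hl n; have := nrm_ge0 (1 + x); nra.
Qed.

(** The element 1 - t is a square root of 1 - c. The map sending t to
(c + t^2)/2 is a contraction near 0, and its iterates from 0 inherit
self-adjointness and commutation with b. *)
Lemma sqrt_near1 b c : nrm c <= 4^-1 -> star c = c -> b * c = c * b ->
  exists t, [/\ t + t = c + t * t, star t = t & b * t = t * b].
Proof.
move=> hc sc bc.
pose h : R[i] := 2^-1.
have hh (x : B) : h *: x + h *: x = x.
  by rewrite -scalerDl /h -mulr2n -[_ *+ 2]mulr_natl mulfV ?scale1r // pnatr_eq0.
have nh x : nrm (h *: x) = 2^-1 * nrm x.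
  by rewrite nrmZ /h -[2](rmorph_nat (real_complex R)) -fmorphV cmodR // invr_ge0.
have sh (x : B) : star (h *: x) = h *: star x.
  by rewrite starZ /h -[2](rmorph_nat (real_complex R)) -fmorphV conjc_real.
pose t n := iter n (fun t => h *: (c + t * t)) 0.
have tS n : t n.+1 = h *: (c + t n * t n) by [].
have tn n : nrm (t n) <= 4^-1.
  elim: n => [|n IH]; first by rewrite nrm0 invr_ge0.
  rewrite tS nh; have := nrmD c (t n * t n); have := nrmM (t n) (t n).
  by have := nrm_ge0 (t n); nra.
have ts n : star (t n) = t n.
  by elim: n => [|n IH]; rewrite ?star0 // tS sh starD starM IH sc.
have tb n : b * t n = t n * b.
  elim: n => [|n IH]; first by rewrite mulr0 mul0r.
  by rewrite tS -scalerAr -scalerAl mulrDr mulrDl bc mulrA IH -!mulrA IH.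
have td n : nrm (t n.+1 - t n) <= 1 * 2^-1 ^+ n.
  rewrite mul1r; elim: n => [|n IH].
    by rewrite tS /= subr0 expr0 nh mulr0 addr0; lra.
  rewrite [t n.+2]tS {2}[t n.+1]tS -scalerBr nh exprS ler_wpM2l ?invr_ge0 //.
  rewrite opprD addrACA subrr add0r.
  rewrite (_ : _ - _ = t n.+1 * (t n.+1 - t n) + (t n.+1 - t n) * t n); last first.
    by rewrite mulrBr mulrBl addrA subrK.
  have h1 := nrmD (t n.+1 * (t n.+1 - t n)) ((t n.+1 - t n) * t n).
  have h2 := nrmM (t n.+1) (t n.+1 - t n).
  have h3 := nrmM (t n.+1 - t n) (t n).
  have := tn n.+1; have := tn n; have := nrm_ge0 (t n.+1 - t n).
  have := nrm_ge0 (t n.+1); have := nrm_ge0 (t n); nra.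
have [l hl] := complete_geometric td; exists l; split.
- apply: (@eq_geometric _ _ _ _ (2 * (2 + (nrm l + 4^-1)))) => n.
  rewrite (_ : _ - _ = ((l - t n.+1) + (l - t n.+1)) - (l * (l - t n) + (l - t n) * t n)); last first.
    have -> : l * (l - t n) + (l - t n) * t n = l * l - t n * t n.
      by rewrite mulrBr mulrBl addrA subrK.
    have -> : l - t n.+1 + (l - t n.+1) = l + l - (c + t n * t n).
      by rewrite addrACA -opprD tS hh.
    rewrite -[RHS]addrA -opprD; congr (_ - _).
    by rewrite [l * l - _]addrC addrA addrK.
  have h1 := nrmB ((l - t n.+1) + (l - t n.+1)) (l * (l - t n) + (l - t n) * t n).
  have h2 := nrmD (l - t n.+1) (l - t n.+1).
  have h3 := nrmD (l * (l - t n)) ((l - t n) * t n).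
  have h4 := nrmM l (l - t n); have h5 := nrmM (l - t n) (t n).
  have := hl n; have := hl n.+1; rewrite ![nrm (t _ - l)]nrmBC exprS.
  have := tn n; have := nrm_ge0 l; have := nrm_ge0 (l - t n).
  have p : 0 <= 2^-1 ^+ n :> R by rewrite exprn_ge0 // invr_ge0.
  have := nrm_ge0 (t n); nra.
- apply: (@eq_geometric _ _ _ _ 4) => n.
  rewrite (_ : _ - _ = star (l - t n) + (t n - l)); last first.
    by rewrite starD starN ts addrA subrK.
  apply: le_trans (nrmD _ _) _; rewrite nrm_star nrmBC; have := hl n; lra.
- apply: (@eq_geometric _ _ _ _ (4 * nrm b)) => n.
  rewrite (_ : _ - _ = b * (l - t n) - (l - t n) * b); last first.
    by rewrite mulrBr mulrBl tb opprB addrA subrK.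
  apply: le_trans (nrmB _ _) _.
  have h1 := nrmM b (l - t n); have h2 := nrmM (l - t n) b.
  have := hl n; rewrite nrmBC; have := nrm_ge0 b; nra.
Qed.

(** With s = (1 - b^2)^(1/2), the unitary is w = b + i s. *)
Lemma mean_of_unitaries b : nrm b <= 2^-1 -> star b = b ->
  exists w, [/\ star w * w = 1, w * star w = 1 & b + b = w + star w].
Proof.
move=> hb sb.
have [|||t [et st bt]] := @sqrt_near1 b (b * b).
- by have := nrmM b b; have := nrm_ge0 b; nra.
- by rewrite starM sb.
- by rewrite mulrA.
(* The relation t + t = b^2 + t^2 says that (1 - t)^2 = 1 - b^2. *)
pose s := 1 - t; pose i : R[i] := 'i%C.
have ss : b * b + s * s = 1.
  have -> : b * b = t + t - t * t by rewrite et addrK.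
  rewrite /s mulrBl mul1r mulrBr mulr1 opprB -[1 - t + _]addrA [LHS]addrCA.
  by rewrite [- t + _]addrCA -opprD -[_ * _ - (_ + _)]opprB subrr addr0.
have sS : star s = s by rewrite /s starD starN st star1.
have bs : b * s = s * b by rewrite /s mulrBl mulrBr bt mul1r mulr1.
have sw : star (b + i *: s) = b - i *: s.
  rewrite starD starZ sb sS /i; congr (_ + _).
  by rewrite -scaleNr; congr (_ *: _); apply/eqP; rewrite eq_complex /= oppr0 !eqxx.
have ii : i * i = -1 by rewrite /i -expr2 sqr_i.
exists (b + i *: s); rewrite sw; split.
- rewrite mulrDr !mulrBl -!scalerAl -!scalerAr scalerA ii bs scaleN1r opprK.
  by rewrite addrA subrK.
- rewrite mulrBr !mulrDl -!scalerAl -!scalerAr scalerA ii bs scaleN1r.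
  by rewrite opprB addrACA subrr addr0.
- by rewrite addrACA subrr addr0.
Qed.

End BanachAlgebra.

(** * Boundedness principles *)

Section BoundedMaps.
Context (R : realType) (B : cstarAlgType R).
Local Notation nrm := (@nrm R B).

(** Homogeneity turns a bound on a ball into a linear bound. *)
Lemma bounded_on_ball (f : B -> B) (r M : R) :
  (forall (a : R[i]) b, f (a *: b) = a *: f b) -> 0 < r ->
  (forall b, nrm b <= r -> nrm (f b) <= M) ->
  forall b, nrm (f b) <= M / r * nrm b.
Proof.
move=> fZ r0 fM b; have [b0|n0] := eqVneq (nrm b) 0.
  have -> : f b = 0 by rewrite (nrm_eq0 b0) -(scale0r (0 : B)) fZ !scale0r.
  by rewrite b0 mulr0 nrm0.
have p : 0 < nrm b by rewrite lt_def n0 nrm_ge0.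
have q : 0 < r / nrm b by rewrite divr_gt0.
have := fM ((r / nrm b)%:C%C *: b).
rewrite fZ !nrmR ?(ltW q) // divfK // lexx => /(_ isT).
move=> h; rewrite -(ler_pM2l q); apply: le_trans h _.
rewrite le_eqVlt; apply/orP; left; apply/eqP; field.
by rewrite n0 gt_eqF.
Qed.

(** The sets where all T i are bounded by k are closed and cover B; one of
them contains a ball, and differences recentre it at 0. *)
Lemma uniform_boundedness (I : Type) (T : I -> B -> B) :
  (forall i b c, T i (b + c) = T i b + T i c) ->
  (forall i (a : R[i]) b, T i (a *: b) = a *: T i b) ->
  (forall i, exists C, forall b, nrm (T i b) <= C * nrm b) ->
  (forall b, exists M, forall i, nrm (T i b) <= M) ->
  exists M, forall i b, nrm (T i b) <= M * nrm b.
Proof.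
move=> TD TZ Tb Tp.
have [||k [x [r [r0 hr]]]] :=
  @baire_cover _ B (fun k b => forall i, nrm (T i b) <= k%:R).
- move=> k b h i; have [C hC] := Tb i.
  apply/ler_addgt0Pr => e e0.
  have [] := h (e / (`|C| + 1)); first by rewrite divr_gt0 // ltr_wpDl.
  move=> y hy yb.
  have -> : T i b = T i y - T i (y - b).
    by rewrite -[X in _ - T i (_ + X)]scaleN1r TD TZ scaleN1r opprD opprK addrA subrr add0r.
  apply: le_trans (nrmB _ _) _; apply: lerD (hy i) _.
  apply: le_trans (hC _) _.
  have C1 : 0 < `|C| + 1 by rewrite ltr_wpDl.
  rewrite ltr_pdivlMr // in yb.
  by have := ler_norm C; have := nrm_ge0 (y - b); nra.
- move=> b; have [M hM] := Tp b; exists (Num.truncn M).+1 => i.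
  by apply: le_trans (hM i) (ltW _); rewrite truncnS_gt.
exists ((k%:R + k%:R) / (r / 2)) => i b.
apply: bounded_on_ball; [exact: TZ|by rewrite divr_gt0|] => {}b hb.
have -> : T i b = T i (b + x) - T i x by rewrite TD addrK.
apply: le_trans (nrmB _ _) _; apply: lerD; apply: hr.
  by rewrite addrK; lra.
by rewrite subrr nrm0.
Qed.

End BoundedMaps.

Lemma imaginary_unit (R : realType) :
  exists i : R[i], [/\ i^*%C = - i, i * i = -1, cmod i = 1 & i != 0].
Proof.
exists 'i%C; split; [|by rewrite -expr2 sqr_i|exact: cmodi|].
  by apply/eqP; rewrite eq_complex /= oppr0 !eqxx.
by rewrite eq_complex /= oner_eq0 andbF.
Qed.

(** Two is invertible in the scalars, which is what polarization and
antisymmetry arguments need. *)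
Lemma double_inj (R : realType) (V : lmodType R[i]) (x y : V) :
  x + x = y + y -> x = y.
Proof.
move=> h; apply: (@scalerI _ _ (2 : R[i])); first by rewrite pnatr_eq0.
by rewrite -[2]/(1 + 1) !scalerDl !scale1r.
Qed.

(** * Conditional expectations and boundedness of moments *)

Section ConditionalExpectation.
Context (R : realType) (B : cstarAlgType R) (A : starAlgType R).
Context (emb : B -> A) (Phi : A -> B).
Hypotheses (hemb : star_embedding emb)
  (hPhi : positive_conditional_expectation emb Phi).
Implicit Types (a : R[i]) (b c : B) (x y : A).

Lemma emb0 : emb 0 = 0.
Proof. by rewrite -(scale0r (0 : B)) (embZ hemb) scale0r. Qed.

Lemma embN b : emb (- b) = - emb b.
Proof. by rewrite -scaleN1r (embZ hemb) scaleN1r. Qed.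

Lemma emb_sum (I : Type) (s : seq I) (P : pred I) (F : I -> B) :
  emb (\sum_(i <- s | P i) F i) = \sum_(i <- s | P i) emb (F i).
Proof.
by elim/big_rec2: _ => [|i x y _ <-]; rewrite ?emb0 ?(embD hemb).
Qed.

Lemma embX b n : emb (b ^+ n.+1) = emb b ^+ n.+1.
Proof.
by elim: n => [|n IH]; rewrite ?expr1 // exprS (embM hemb) IH -exprS.
Qed.

Lemma condexp0 : Phi 0 = 0.
Proof. by rewrite -emb0 (condexp_id hPhi). Qed.

Lemma condexpM b c x : Phi (emb b * x * emb c) = b * Phi x * c.
Proof. by rewrite -[X in Phi X]addr0 (condexp_bimod hPhi) condexp0 addr0. Qed.

Lemma condexpD x y : Phi (x + y) = Phi x + Phi y.
Proof.
have e z : Phi z = Phi (emb 1 * z * emb 1) by rewrite condexpM mul1r mulr1.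
rewrite e mulrDr mulrDl (condexp_bimod hPhi) mul1r mulr1.
by rewrite -e.
Qed.

Lemma condexpMl b x : Phi (emb b * x) = b * Phi x.
Proof.
have := condexpM 1 1 (emb b * x); rewrite mul1r mulr1 => <-.
by rewrite mulrA -(embM hemb) mul1r condexpM mulr1.
Qed.

Lemma condexpMr b x : Phi (x * emb b) = Phi x * b.
Proof.
have := condexpM 1 1 (x * emb b); rewrite mul1r mulr1 => <-.
by rewrite mulrA -mulrA -(embM hemb) mulr1 condexpM mul1r.
Qed.

Lemma condexp1 : Phi 1 = 1.
Proof.
by have := condexpMl 1 1; rewrite mulr1 (condexp_id hPhi) mul1r.
Qed.

Lemma condexpZ a x : Phi (a *: x) = a *: Phi x.
Proof.
have := condexpMl (a *: 1) x.
have := condexpMl 1 (a *: x).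
by rewrite (embZ hemb) -!scalerAl -scalerAr !mul1r => -> ->.
Qed.

Lemma condexpN x : Phi (- x) = - Phi x.
Proof. by rewrite -scaleN1r condexpZ scaleN1r. Qed.

Lemma condexp_sum (I : Type) (s : seq I) (P : pred I) (F : I -> A) :
  Phi (\sum_(i <- s | P i) F i) = \sum_(i <- s | P i) Phi (F i).
Proof.
by elim/big_rec2: _ => [|i x y _ <-]; rewrite ?condexp0 ?condexpD.
Qed.

(** The elements Phi(y^* y) are self-adjoint. Taking y = x + 1 and y = i x + 1
gives two linear relations between Phi(x), Phi(x^* ) and their adjoints,
which determine the adjoint of Phi(x). *)
Lemma condexp_star x : Phi (star x) = star (Phi x).
Proof.
have sa y : star (Phi (star y * y)) = Phi (star y * y).
  by case: (condexp_pos hPhi y).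
have H y : star (Phi (star y)) + star (Phi y) = Phi (star y) + Phi y.
  have := sa (y + 1).
  have -> : star (y + 1) * (y + 1) = star y * y + (star y + y + 1).
    by rewrite starD star1 mulrDl mul1r mulrDr mulr1 -!addrA.
  rewrite condexpD starD sa => /addrI.
  by rewrite !condexpD condexp1 !starD star1 => /addIr.
have [i [iC _ _ i0]] := imaginary_unit R.
have iN : (- i)^*%C = i by rewrite -iC conjcK.
have h1 := H x; have := H (i *: x).
rewrite starZ iC !condexpZ !starZ iN iC => h2.
have {}h2 : star (Phi (star x)) - star (Phi x) = Phi x - Phi (star x).
  by apply: (scalerI i0); rewrite !scalerBr -scaleNr h2 scaleNr addrC.
rewrite -[LHS]starK; congr star; apply: double_inj.
have := congr2 +%R h1 h2; rewrite addrACA subrr addr0.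
by rewrite [Phi (star x) + _]addrC addrACA subrr addr0.
Qed.

(** The seminorm whose completion is Abar. *)
Definition seminorm x : R := Num.sqrt (nrm (Phi (star x * x))).

Lemma seminorm_ge0 x : 0 <= seminorm x.
Proof. exact: sqrtr_ge0. Qed.

Lemma seminorm_sqr x : nrm (Phi (star x * x)) = seminorm x ^+ 2.
Proof. by rewrite sqr_sqrtr // nrm_ge0. Qed.

Section Seminorm.
Context (Abar : completeNormedModType R[i]) (iota : A -> Abar)
  (Phibar : Abar -> nspace B).
Hypothesis hcl : closure_extension Phi iota Phibar.

Lemma iota_seminorm x : `|iota x| = (seminorm x)%:C%C.
Proof.
have /eqP := iota_norm hcl x; rewrite cnormE seminorm_sqr rmorphXn /=.
by rewrite eqrXn2 ?normr_ge0 ?ler0c ?seminorm_ge0 // => /eqP.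
Qed.

Lemma seminormD x y : seminorm (x + y) <= seminorm x + seminorm y.
Proof. by rewrite -lecR rmorphD /= -!iota_seminorm (Defs.iotaD hcl) ler_normD. Qed.

Lemma seminormZ a x : seminorm (a *: x) = cmod a * seminorm x.
Proof. by apply: complexI; rewrite rmorphM /= -!iota_seminorm (iotaZ hcl) normrZ cmodE. Qed.

(** The unit of B need not be that of A, hence the factor emb 1. *)
Lemma seminorm_isometry w x : star w * w = 1 -> seminorm (emb w * x) = seminorm (emb 1 * x).
Proof.
move=> ww; rewrite /seminorm !starM -!(emb_star hemb) -!mulrA.
by rewrite [emb (star w) * _]mulrA [emb (star 1) * _]mulrA -!(embM hemb) ww mulr1 star1.
Qed.

(** A small self-adjoint b is the mean of two unitaries, and the triangle
inequality for the seminorm finishes. This avoids any comparison of positive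
elements in B. *)
Lemma seminorm_selfadjoint b x : star b = b -> nrm b <= 2^-1 ->
  seminorm (emb b * x) <= seminorm (emb 1 * x).
Proof.
move=> sb hb; have [w [w1 w2 bw]] := mean_of_unitaries hb sb.
have := seminormD (emb w * x) (emb (star w) * x).
rewrite (seminorm_isometry x w1) (seminorm_isometry (w := star w)) ?starK // -mulrDl -(embD hemb) -bw.
have -> : emb (b + b) * x = 2%:C%C *: (emb b * x).
  by rewrite (embD hemb) mulrDl [2](natrD _ 1 1) rmorphD /= scalerDl scale1r.
by rewrite seminormZ cmodR //; lra.
Qed.

(** Real and imaginary parts reduce the claim to self-adjoint elements. *)
Lemma seminorm_left_mul b x : nrm b <= 2^-1 -> seminorm (emb b * x) <= 2 * seminorm (emb 1 * x).
Proof.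
move=> hb; pose h : R[i] := (2^-1 : R)%:C%C.
have [i [iC ii i1 _]] := imaginary_unit R.
have hh (c : B) : h *: (c + c) = c.
  rewrite -mulr2n -scaler_nat scalerA /h -(rmorph_nat (real_complex R)) -rmorphM.
  by rewrite mulVf ?pnatr_eq0 // scale1r.
have nh c d : nrm c <= 2^-1 -> nrm d <= 2^-1 -> nrm (h *: (c + d)) <= 2^-1.
  by move=> hc hd; rewrite nrmR ?invr_ge0 //; have := nrmD c d; lra.
have sh (c : B) : star (h *: c) = h *: star c by rewrite starZ conjc_real.
pose c := h *: (b + star b); pose d := h *: (i *: star b - i *: b).
have bE : b = c + i *: d.
  rewrite /c /d scalerA mulrC -scalerA -scalerDr scalerBr !scalerA ii !scaleN1r.
  by rewrite opprK [- _ + _]addrC addrACA subrr addr0 hh.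
rewrite bE (embD hemb) (embZ hemb i d) mulrDl -scalerAl.
apply: le_trans (seminormD _ _) _; rewrite seminormZ i1 mul1r.
have h1 : seminorm (emb c * x) <= seminorm (emb 1 * x).
  apply: seminorm_selfadjoint; first by rewrite sh starD starK addrC.
  by rewrite nh // nrm_star.
have h2 : seminorm (emb d * x) <= seminorm (emb 1 * x).
  apply: seminorm_selfadjoint.
    by rewrite sh starD starN !starZ starK iC !scaleNr opprK addrC.
  by rewrite nh // ?nrmN nrmZ i1 mul1r ?nrm_star.
lra.
Qed.

(** Polarization: 4 x^* y is a combination of four elements (y + c x)^* (y + c x)
with c a fourth root of unity. *)
Lemma condexp_polar x y : nrm (Phi (star x * y)) <= (seminorm x + seminorm y) ^+ 2.
Proof.
pose S z := star (y + z) * (y + z) - star (y - z) * (y - z).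
have SE z : S z = (star y * z + star z * y) *+ 2.
  rewrite /S !starD starN mulrDl mulrBl opprB [X in _ + X]addrC addrACA.
  rewrite -mulrBr -mulrDr opprD opprK addrACA subrr add0r.
  by rewrite [y + z + _]addrACA subrr addr0 mulrnDl !mulr2n !mulrDr.
have Sb z : nrm (Phi (S z)) <= 2 * (seminorm y + seminorm z) ^+ 2.
  rewrite /S condexpD condexpN; apply: le_trans (nrmB _ _) _; rewrite !seminorm_sqr.
  have := seminormD y z; have := seminormD y (- z); rewrite -scaleN1r seminormZ cmodN1 mul1r.
  have := seminorm_ge0 (y + z); have := seminorm_ge0 (y + -1 *: z).
  have := seminorm_ge0 y; have := seminorm_ge0 z.
  move: (seminorm _) (seminorm _) (seminorm _) (seminorm _) => p q r s; nra.
have [i [iC ii i1 _]] := imaginary_unit R.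
have E : (star x * y) *+ 4 = S x + i *: S (i *: x).
  rewrite !SE starZ iC -!scalerAr -!scalerAl -scalerMnr -mulrnDl.
  rewrite -[4%N]/(2 * 2)%N mulrnA; congr (_ *+ 2).
  rewrite scalerDr !scalerA mulrN ii opprK scaleN1r scale1r.
  by rewrite addrACA subrr add0r mulr2n.
have := nrmD (Phi (S x)) (Phi (i *: S (i *: x))).
rewrite -condexpD -E condexpZ nrmZ i1 mul1r.
have -> : Phi (star x * y *+ 4) = (4%:R : R)%:C%C *: Phi (star x * y).
  by rewrite -condexpZ rmorph_nat scaler_nat.
have := Sb x; have := Sb (i *: x).
by rewrite seminormZ i1 mul1r nrmR // [seminorm y + _]addrC; lra.
Qed.

(** This is where positivity of Phi yields continuity. *)
Lemma condexp_mid_bounded x y :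
  exists C, forall b, nrm (Phi (x * emb b * y)) <= C * nrm b.
Proof.
exists ((seminorm (star x) + 2 * seminorm (emb 1 * y)) ^+ 2 / 2^-1).
apply: bounded_on_ball; rewrite ?invr_gt0 //.
  by move=> a b; rewrite (embZ hemb) -scalerAr -scalerAl condexpZ.
move=> b hb; rewrite -mulrA -{1}[x]starK; apply: le_trans (condexp_polar _ _) _.
have := seminorm_left_mul y hb; have := seminorm_ge0 (star x); have := seminorm_ge0 (emb b * y).
have := seminorm_ge0 (emb 1 * y); rewrite !expr2; nra.
Qed.

Definition word x (s : seq B) : A := \prod_(z <- s) (emb z * x).

(** Joint boundedness of a separately bounded multilinear map, by induction on
the number of slots: with all slots but the last in a ball, the maps of the
last slot form a pointwise bounded family of bounded operators. *)
Lemma word_bounded x y n (r : R) : 0 < r ->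
  exists M, forall s, size s = n -> all (fun z => nrm z <= r) s ->
    nrm (Phi (word x s * y)) <= M.
Proof.
move=> r0; elim: n y => [|n IH] y.
  exists (nrm (Phi y)) => s /size0nil -> _.
  by rewrite /word big_nil mul1r.
pose I := {s : seq B | size s = n /\ all (fun z => nrm z <= r) s}.
pose T (s : I) b := Phi (word x (sval s) * emb b * (x * y)).
have [||||M hM] := @uniform_boundedness _ B I T.
- by move=> s b c; rewrite /T (embD hemb) mulrDr mulrDl condexpD.
- by move=> s a b; rewrite /T (embZ hemb) -scalerAr -scalerAl condexpZ.
- by move=> s; exact: condexp_mid_bounded.
- move=> b; have [M hM] := IH (emb b * (x * y)).
  by exists M => -[s [s1 s2]]; rewrite /T /= -mulrA; exact: hM.
exists (`|M| * r) => s; case/lastP: s => // s z.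
rewrite size_rcons => -[ssz]; rewrite all_rcons => /andP[zr sr].
have := hM (exist _ s (conj ssz sr)) z; rewrite /T /=.
have -> : word x (rcons s z) * y = word x s * emb z * (x * y).
  by rewrite /word -cats1 big_cat big_seq1 /= !mulrA.
move/le_trans; apply.
apply: le_trans (ler_wpM2r (nrm_ge0 z) (ler_norm M)) _.
by rewrite ler_wpM2l.
Qed.

Lemma word_nseq x n z : word x (nseq n z) = (emb z * x) ^+ n.
Proof.
by elim: n => [|n IH]; rewrite /word /= ?big_nil ?big_cons ?expr0 // exprS -IH.
Qed.

(** The homogeneous part of degree n of the series defining vartheta_x(z). *)
Definition moment x n z : B := Phi ((emb z * x) ^+ n).

Lemma moment_bounded x n (r : R) : 0 < r ->
  exists M, forall z, nrm z <= r -> nrm (moment x n z) <= M.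
Proof.
move=> r0; have [M hM] := word_bounded x 1 n r0; exists M => z zr.
rewrite /moment -word_nseq -[word _ _]mulr1; apply: hM.
  by rewrite size_nseq.
by rewrite all_nseq zr orbT.
Qed.

End Seminorm.
End ConditionalExpectation.

(** * Cauchy estimates for polynomials in a complex parameter *)

Section CauchyEstimates.
Context (R : realType) (B : cstarAlgType R).
Local Notation nrm := (@nrm R B).

(** Orthogonality of the powers of a primitive root, the discrete form of
Cauchy's integral formula. *)
Lemma sum_unity_root n (w : R[i]) e : n.-primitive_root w ->
  \sum_(j < n) (w ^+ e) ^+ j = if (n %| e)%N then n%:R else 0.
Proof.
move=> pw; have [ne|ne] := boolP (n %| e)%N.
  have -> : w ^+ e = 1 by apply/eqP; rewrite -(prim_order_dvd pw).
  by under eq_bigr do rewrite expr1n; rewrite sumr_const card_ord.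
have x1 : w ^+ e - 1 != 0 by rewrite subr_eq0 -(prim_order_dvd pw).
apply: (mulfI x1); rewrite mulr0 -subrX1 -exprM mulnC exprM.
by rewrite (prim_expr_order pw) expr1n subrr.
Qed.

(** Averaging the polynomial over D points of the circle of radius r against
the conjugate character isolates its k-th coefficient. *)
Lemma cauchy_estimate (c : nat -> B) D (r M : R) : 0 < r ->
  (forall t, cmod t = r -> nrm (\sum_(k < D) t ^+ k *: c k) <= M) ->
  forall k, (k < D)%N -> nrm (c k) * r ^+ k <= M.
Proof.
move=> r0 hM k kD; have D0 : (0 < D)%N by apply: leq_ltn_trans kD.
(* Multiplication by w^((D - k) j), which is w^(-kj), selects degree k. *)
have [w pw] := primitive_root_complex R D0.
have w1 : cmod w = 1 := cmod_unity_root D0 (prim_expr_order pw).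
pose t j := r%:C%C * w ^+ j.
have tr j : cmod (t j) = r.
  by rewrite cmodM cmodX w1 expr1n mulr1 cmodR // ltW.
have E : \sum_(j < D) w ^+ ((D - k) * j) *: (\sum_(m < D) t j ^+ m *: c m) =
         (D%:R * r ^+ k)%:C%C *: c k.
  have coef m : \sum_(j < D) w ^+ ((D - k) * j) * t j ^+ m =
      r%:C%C ^+ m * (if (D %| D - k + m)%N then D%:R else 0).
    rewrite -(sum_unity_root _ pw) mulr_sumr; apply: eq_bigr => j _.
    by rewrite exprMn mulrCA -!exprM -exprD [(j * m)%N]mulnC -mulnDl.
  under eq_bigr => j _ do (rewrite scaler_sumr; under eq_bigr do rewrite scalerA).
  rewrite exchange_big /=; under eq_bigr => m _ do rewrite -scaler_suml coef.
  rewrite (bigD1 (Ordinal kD)) //= big1 ?addr0 => [|m].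
    by rewrite subnK ?dvdnn 1?ltnW // rmorphM rmorph_nat rmorphXn mulrC.
  rewrite -val_eqE /= => mk; have /negbTE-> : ~~ (D %| D - k + m)%N.
    apply/dvdnP => -[[|[|q]]] e; have := ltn_ord m; move/eqP: mk; lia.
  by rewrite mulr0 scale0r.
have DR : 0 < D%:R :> R by rewrite ltr0n.
rewrite -(ler_pM2l DR) [nrm _ * _]mulrC mulrA.
rewrite -nrmR ?mulr_ge0 ?exprn_ge0 ?(ltW r0) ?(ltW DR) //.
rewrite -E; apply: le_trans (nrm_sum _ _ _) _.
rewrite (@le_trans _ _ (\sum_(j < D) M)) //; last first.
  by rewrite sumr_const card_ord mulr_natl.
by apply: ler_sum => j _; rewrite nrmZ cmodX w1 expr1n mul1r hM.
Qed.

Lemma cauchy_tail (c : nat -> B) D (r M : R) : 2 <= r ->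
  (forall t, cmod t = r -> nrm (\sum_(k < D) t ^+ k *: c k) <= M) ->
  forall K, nrm (\sum_(K <= k < D) c k) <= 2 * M * r^-1 ^+ K.
Proof.
move=> r2 hM K; have r0 : 0 < r by lra.
have M0 : 0 <= M.
  by have := hM r%:C%C (cmodR (ltW r0)); apply: le_trans; apply: nrm_ge0.
have hc := cauchy_estimate r0 hM.
apply: le_trans (nrm_sum _ _ _) _.
rewrite (@le_trans _ _ (\sum_(K <= k < D) M * r^-1 ^+ k)) //.
  rewrite big_nat_cond [X in _ <= X]big_nat_cond.
  apply: ler_sum => k /andP[/andP[_ kD] _].
  by rewrite exprVn ler_pdivlMr ?exprn_gt0 // hc.
rewrite -mulr_sumr [2 * M]mulrC -mulrA ler_wpM2l //.
apply: sum_geometric_le; first by rewrite invr_ge0 ltW.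
by rewrite lef_pV2 ?posrE ?ltr0n.
Qed.

End CauchyEstimates.

Section PolynomialPaths.
Context (R : realType) (B : cstarAlgType R) (A : starAlgType R).
Context (emb : B -> A) (Phi : A -> B).
Hypotheses (hemb : star_embedding emb)
  (hPhi : positive_conditional_expectation emb Phi).
Implicit Types (P Q : {poly A}) (t : R[i]).
Local Notation nrm := (@nrm R B).

(** Evaluation of polynomials over the noncommutative ring A is multiplicative
at scalars, because these are central. *)
Lemma comm_poly_scalar P t : comm_poly P t%:A.
Proof. by rewrite /comm_poly mulr_algl mulr_algr. Qed.

Lemma eval_scalarM P Q t : (P * Q).[t%:A] = P.[t%:A] * Q.[t%:A].
Proof. by rewrite hornerM_comm //; apply: comm_poly_scalar. Qed.

Lemma eval_scalarX P n t : (P ^+ n).[t%:A] = P.[t%:A] ^+ n.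
Proof.
elim: n => [|n IH]; first by rewrite !expr0 hornerC.
by rewrite !exprS eval_scalarM IH.
Qed.

Lemma eval_scalarE P D t : (size P <= D)%N ->
  P.[t%:A] = \sum_(k < D) t ^+ k *: P`_k.
Proof.
move=> sP; rewrite (horner_coef_wide _ sP); apply: eq_bigr => k _.
by rewrite exprZn expr1n mulr_algr.
Qed.

Lemma condexp_eval P D t : (size P <= D)%N ->
  Phi P.[t%:A] = \sum_(k < D) t ^+ k *: Phi P`_k.
Proof.
move=> sP; rewrite (eval_scalarE t sP) (condexp_sum hemb hPhi).
by apply: eq_bigr => k _; rewrite (condexpZ hemb hPhi).
Qed.

Lemma condexp_coef_bound P (r M : R) : 0 < r ->
  (forall t, cmod t = r -> nrm (Phi P.[t%:A]) <= M) ->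
  forall k, nrm (Phi P`_k) * r ^+ k <= M.
Proof.
move=> r0 hM k.
apply: (@cauchy_estimate _ _ (fun k => Phi P`_k) (maxn (size P) k.+1)) => //.
  move=> t tr; rewrite -condexp_eval ?leq_maxl //; exact: hM.
exact: leq_maxr.
Qed.

(** A polynomial path bounded on |t| = r is determined at t = 1 by its first K
coefficients up to an error of order r^-K. *)
Lemma condexp_tail_bound P (r M : R) : 2 <= r ->
  (forall t, cmod t = r -> nrm (Phi P.[t%:A]) <= M) ->
  forall K, nrm (Phi P.[1] - \sum_(k < K) Phi P`_k) <= 2 * M * r^-1 ^+ K.
Proof.
move=> r2 hM K; pose D := maxn (size P) K.
have sP : (size P <= D)%N by apply: leq_maxl.
have -> : Phi P.[1] = \sum_(k < D) Phi P`_k.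
  rewrite -[1](scale1r (1 : A)) (condexp_eval _ sP).
  by apply: eq_bigr => k _; rewrite expr1n scale1r.
rewrite -!(big_mkord xpredT (fun k => Phi P`_k)) /=.
rewrite (big_cat_nat (n := K)) ?leq_maxr //= addrAC subrr add0r.
apply: cauchy_tail => // t tr; rewrite -condexp_eval //; exact: hM.
Qed.

Section Line.
Variables (x : A) (z d : B).

(** The n-th power of this polynomial restricts the moment of order n to the
complex line z + t d. *)
Definition line_poly : {poly A} := (emb z * x)%:P + (emb d * x)%:P * 'X.

Lemma eval_line t : line_poly.[t%:A] = emb (z + t *: d) * x.
Proof.
rewrite /line_poly hornerD hornerMX !hornerC mulr_algr.
by rewrite (embD hemb) (embZ hemb) mulrDl scalerAl.
Qed.

Lemma coef_line_low n : (line_poly ^+ n)`_0 = (emb z * x) ^+ n.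
Proof.
elim: n => [|n IH]; first by rewrite !expr0 coef1.
by rewrite !exprS coefM big_ord1 IH coefD coefC coefMX addr0.
Qed.

Lemma coef_line_high n :
  (line_poly ^+ n)`_n = (emb d * x) ^+ n /\ forall k, (n < k)%N -> (line_poly ^+ n)`_k = 0.
Proof.
elim: n => [|n [IH IHk]].
  by split=> [|k k0]; rewrite !expr0 coef1 ?eqxx // gtn_eqF.
have cS k : (line_poly ^+ n.+1)`_k.+1 =
    emb z * x * (line_poly ^+ n)`_k.+1 + emb d * x * (line_poly ^+ n)`_k.
  by rewrite exprS mulrDl coefD coefCM -mulrA -commr_polyX mulrA coefMX coefCM.
split=> [|[|k] // nk]; rewrite cS.
  by rewrite IHk // mulr0 add0r IH exprS.
by rewrite !IHk // ?mulr0 ?addr0 // ltnW.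
Qed.

(** The tail bound with only the constant term removed gives a Lipschitz estimate;
a large r is available when d is small. *)
Lemma moment_line n (r M : R) : 2 <= r ->
  (forall t, cmod t = r -> nrm (moment emb Phi x n (z + t *: d)) <= M) ->
  nrm (moment emb Phi x n (z + d) - moment emb Phi x n z) <= 2 * M / r.
Proof.
move=> r2 hM; have := @condexp_tail_bound (line_poly ^+ n) r M r2 _ 1%N.
have -> : (line_poly ^+ n).[1] = (emb (z + d) * x) ^+ n.
  by rewrite -[1](scale1r (1 : A)) eval_scalarX eval_line scale1r.
rewrite big_ord1 coef_line_low expr1; apply=> t tr.
by rewrite eval_scalarX eval_line; apply: hM.
Qed.

(** The leading coefficient on the line through z in the direction d is the moment
at d; this moves a bound near z to a bound near 0. *)
Lemma moment_leading n (r M : R) : 0 < r ->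
  (forall t, cmod t = r -> nrm (moment emb Phi x n (z + t *: d)) <= M) ->
  nrm (moment emb Phi x n d) * r ^+ n <= M.
Proof.
move=> r0 hM; have := @condexp_coef_bound (line_poly ^+ n) r M r0 _ n.
rewrite (coef_line_high n).1; apply=> t tr.
by rewrite eval_scalarX eval_line; apply: hM.
Qed.

End Line.
End PolynomialPaths.

(** * Uniform growth of moments *)

Section MomentGrowth.
Context (R : realType) (B : cstarAlgType R) (A : starAlgType R).
Context (emb : B -> A) (Phi : A -> B).
Hypotheses (hemb : star_embedding emb)
  (hPhi : positive_conditional_expectation emb Phi).
Context (Abar : completeNormedModType R[i]) (iota : A -> Abar)
  (Phibar : Abar -> nspace B).
Hypothesis hcl : closure_extension Phi iota Phibar.
Local Notation nrm := (@nrm R B).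
Local Notation moment := (moment emb Phi).
Implicit Types (x : A) (z d : B) (n : nat).

Lemma momentZ x n (a : R[i]) z : moment x n (a *: z) = a ^+ n *: moment x n z.
Proof.
by rewrite /moment (embZ hemb) -scalerAl exprZn (condexpZ hemb hPhi).
Qed.

Lemma moment0 x z : moment x 0 z = 1.
Proof. by rewrite /moment expr0 (condexp1 hemb hPhi). Qed.

Lemma moment_continuous x n z (e : R) : 0 < e ->
  exists2 r, 0 < r & forall y, nrm (y - z) < r -> nrm (moment x n y - moment x n z) < e.
Proof.
move=> e0; have z1 : 0 < nrm z + 1 by rewrite ltr_wpDl ?nrm_ge0.
have [M hM] := moment_bounded hemb hPhi hcl x n z1.
have M0 : 0 <= M.
  by apply: le_trans (nrm_ge0 _) (hM z _); rewrite lerDl.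
exists (Num.min 2^-1 (e / (2 * M + 1))).
  by rewrite lt_min invr_gt0 ltr0n divr_gt0 //; lra.
move=> y; rewrite lt_min => /andP[y1 y2].
have [d0|dn] := eqVneq (nrm (y - z)) 0.
  by rewrite -[y](subrK z) (nrm_eq0 d0) add0r subrr nrm0.
have dp : 0 < nrm (y - z) by rewrite lt_def dn nrm_ge0.
have -> : y = z + (y - z) by rewrite addrC subrK.
have := @moment_line _ _ _ _ _ hemb hPhi x z (y - z) n (nrm (y - z))^-1 M.
move=> H; apply: le_lt_trans (H _ _) _.
- by rewrite -[2]invrK lef_pV2 ?posrE ?invr_gt0 // ltW.
- move=> t tr; apply: hM; apply: le_trans (nrmD _ _) _.
  by rewrite nrmZ tr mulVf.
rewrite invrK; rewrite ltr_pdivlMr in y2; last lra.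
by nra.
Qed.

Definition moment_growth x (C L : R) :=
  forall n z, nrm (moment x n z) <= C * (L * nrm z) ^+ n.

(** The sets where the n-th moment is at most k^(n+1) for all n are closed and,
by homogeneity, cover B. One of them contains a ball, whose centre is moved
to 0 by taking leading coefficients on lines. *)
Lemma moment_growth_of_bounded x (r : R) : 0 < r ->
  (forall z, nrm z < r -> exists C, forall n, nrm (moment x n z) <= C) ->
  exists C L, [/\ 1 <= C, 1 <= L & moment_growth x C L].
Proof.
move=> r0 hb.
have [||k [z0 [s [s0 hs]]]] :=
  @baire_cover _ B (fun k z => forall n, nrm (moment x n z) <= k%:R ^+ n.+1).
- move=> k z h n; apply/ler_addgt0Pr => e e0.
  have [d d0 hd] := moment_continuous x n z e0.
  have [y Fy yz] := h _ d0.
  have h1 := nrmD (moment x n y) (moment x n z - moment x n y).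
  rewrite addrC subrK in h1; have h2 := hd _ yz; rewrite nrmBC in h2.
  have h3 := Fy n; lra.
- move=> z; pose m := (Num.truncn (nrm z / r)).+1.
  have mz : nrm z / r < m%:R by rewrite truncnS_gt.
  have m0 : 0 < m%:R :> R by rewrite ltr0n.
  have [|C hC] := hb ((m%:R^-1 : R)%:C%C *: z).
    by rewrite nrmR ?invr_ge0 ?(ltW m0) // mulrC ltr_pdivrMr // mulrC -ltr_pdivrMr.
  pose k := maxn m (Num.truncn C).+1; exists k => n.
  have Ck : C <= k%:R.
    apply: (@le_trans _ _ (Num.truncn C).+1%:R); first by rewrite ltW // truncnS_gt.
    by rewrite ler_nat leq_maxr.
  have -> : z = (m%:R : R)%:C%C *: ((m%:R^-1 : R)%:C%C *: z).
    by rewrite scalerA -rmorphM mulfV ?gt_eqF // scale1r.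
  rewrite momentZ -rmorphXn nrmR ?exprn_ge0 ?(ltW m0) // exprS mulrC.
  apply: ler_pM; rewrite ?nrm_ge0 ?exprn_ge0 ?(ltW m0) //.
    exact: le_trans (hC n) Ck.
  by rewrite lerXn2r ?nnegrE ?ler0n // ler_nat leq_maxl.
have k0 : 0 <= k%:R :> R by [].
have ks : 0 <= 2 * k%:R / s by rewrite divr_ge0 ?mulr_ge0 ?(ltW s0).
exists (k%:R + 1), (2 * k%:R / s + 1); split; [lra|lra|move=> n z].
have [z00|zn] := eqVneq (nrm z) 0.
  case: n => [|n]; first by rewrite moment0 nrm1 mulr1; lra.
  rewrite (nrm_eq0 z00) /moment (emb0 hemb) mul0r expr0n /=.
  rewrite (condexp0 hemb hPhi) nrm0 mulr0 mulr_ge0 ?exprn_ge0 //; lra.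
have zp : 0 < nrm z by rewrite lt_def zn nrm_ge0.
(* On |t| = q the point z0 + t z stays in the ball of radius s around z0. *)
have [q qE] : exists q : R, q = s / (2 * nrm z) by eexists.
have q0 : 0 < q by rewrite qE divr_gt0 ?mulr_gt0.
have := @moment_leading _ _ _ _ _ hemb hPhi x z0 z n q (k%:R ^+ n.+1) q0.
rewrite -ler_pdivlMr ?exprn_gt0 // => H; apply: le_trans (H _) _ => [t tq|].
  apply: hs; rewrite addrC addKr nrmZ tq qE.
  rewrite (_ : _ * _ = s / 2); first by lra.
  by field.
have -> : k%:R ^+ n.+1 / q ^+ n = k%:R * (k%:R / q) ^+ n.
  by rewrite [in RHS]exprMn exprVn exprS mulrA.
apply: ler_pM; rewrite ?exprn_ge0 ?mulr_ge0 //.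
- by rewrite invr_ge0 ltW.
- lra.
rewrite lerXn2r ?nnegrE ?mulr_ge0 ?invr_ge0 ?(ltW q0) //; try lra.
rewrite (_ : _ / q = 2 * k%:R / s * nrm z); first by rewrite ler_wpM2r ?(ltW zp) // lerDl.
by rewrite qE; field; rewrite zn gt_eqF.
Qed.

End MomentGrowth.

(** * The combinatorics of words in a monotone pair *)

Section TriangularSums.

Lemma sum_triangle (V : nmodType) n (F : nat -> nat -> V) :
  \sum_(k < n) \sum_(j < n - k) F k j = \sum_(j < n) \sum_(k < n - j) F k j.
Proof.
have E (G : nat -> nat -> V) : \sum_(k < n) \sum_(j < n - k) G k j =
    \sum_(k < n) \sum_(j < n | (k + j < n)%N) G k j.
  apply: eq_bigr => k _.
  rewrite (big_ord_widen n (G k)) ?leq_subr //.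
  by apply: eq_bigl => j; rewrite ltn_subRL.
rewrite E (E (fun j k => F k j)) (exchange_big_dep xpredT) //=.
by apply: eq_bigr => j _; apply: eq_bigl => k; rewrite addnC.
Qed.

(** Exchanging the two indices preserves the triangle and changes the sign. *)
Lemma sum_antisymmetric_triangle (R : realType) (V : lmodType R[i]) n
    (F : nat -> nat -> V) :
  (forall k j, (k + j < n)%N -> F k j = - F j k) ->
  \sum_(k < n) \sum_(j < n - k) F k j = 0.
Proof.
move=> hF; apply: double_inj; rewrite addr0 {1}sum_triangle -big_split /=.
apply: big1 => k _; rewrite -big_split; apply: big1 => j _ /=.
by rewrite (hF j k) ?addNr // addnC -ltn_subRL.
Qed.

End TriangularSums.

Section MonotonePairs.
Context (R : realType) (B : cstarAlgType R) (A : starAlgType R).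
Context (emb : B -> A) (Phi : A -> B).
Hypotheses (hemb : star_embedding emb)
  (hPhi : positive_conditional_expectation emb Phi).
Local Notation gen := (gen_subalgebra emb).

(** The consequences of independence of (u, v) that are used. The same u stands
on both sides of y in the first field, and the same y on both sides of x in
the last one, since independence concerns a single family of elements. *)
Record monotone_pair (u v : A) : Prop := MonotonePair {
  mp_mid : forall y, gen v y -> forall a b,
    Phi (a * u * y * u * b) = Phi (a * u * emb (Phi y) * u * b) ;
  mp_low_high : forall x y, gen u x -> gen v y -> Phi (x * y) = Phi x * Phi y ;
  mp_high_low : forall x y, gen u x -> gen v y -> Phi (y * x) = Phi y * Phi x ;
  mp_high_low_high : forall x y, gen u x -> gen v y ->
    Phi (y * x * y) = Phi y * Phi x * Phi y }.

Lemma gen_zero u : gen u 0.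
Proof. by rewrite -(scale0r u); apply: gen_scale; apply: gen_base. Qed.

Lemma gen_sum u (I : Type) (s : seq I) (P : pred I) (F : I -> A) :
  (forall i, P i -> gen u (F i)) -> gen u (\sum_(i <- s | P i) F i).
Proof.
by move=> h; elim/big_rec: _ => [|i x Pi hx]; [exact: gen_zero|apply: gen_add; auto].
Qed.

Lemma gen_exp x z k : gen x ((emb z * x) ^+ k.+1).
Proof.
have g1 : gen x (emb z * x) by apply: gen_mull; apply: gen_base.
by elim: k => [|k IH]; rewrite ?expr1 // exprS; apply: gen_mul.
Qed.

Section Blocks.
Variables (u : A) (v : nat -> B).

(** The sequence block with an explicit bound on the depth of its recursion. *)
Fixpoint block_fuel f n : A :=
  if f is f'.+1 then
    if n is n'.+1 then \sum_(k < n'.+1) u * emb (v k.+1) * block_fuel f' (n' - k)%N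
    else u
  else 0.

(** The part of degree n of the sum of the words u v_k1 u v_k2 ... v_km u,
the degree being k1 + ... + km. *)
Definition block n := block_fuel n.+1 n.

Arguments block : simpl never.

Lemma block_fuelE f n : (n < f)%N -> block_fuel f n = block n.
Proof.
suff H g : forall f n, (n < f)%N -> (n < g)%N -> block_fuel f n = block_fuel g n.
  by move=> nf; apply: H.
elim: g => [|g IH] [|{}f] [|{}n] //= nf ng.
by apply: eq_bigr => k _; rewrite (IH f) // (leq_ltn_trans (leq_subr _ _)).
Qed.

Lemma block0 : block 0 = u. Proof. by []. Qed.

Lemma blockS n : block n.+1 = \sum_(k < n.+1) u * emb (v k.+1) * block (n - k)%N.
Proof.
rewrite -[LHS]/(\sum_(k < n.+1) u * emb (v k.+1) * block_fuel n.+1 (n - k)%N).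
apply: eq_bigr => k _.
by rewrite block_fuelE // ltnS leq_subr.
Qed.

Lemma gen_block n : gen u (block n).
Proof.
elim/ltn_ind: n => -[|n] IH; first exact: gen_base.
rewrite blockS; apply: gen_sum => k _.
apply: gen_mul; first by apply: gen_mulr; apply: gen_base.
by apply: IH; rewrite ltnS leq_subr.
Qed.

(** Both the words (zVU)^n with their inner blocks replaced and the resolvent
of wU satisfy the recursion assumed here; they differ in the contribution
th j of the last block, of degree j. *)
Lemma block_expansion (K : nat) (X : nat -> A) (th : nat -> A -> B) :
  (forall j x y, th j (x + y) = th j x + th j y) ->
  (forall a, Phi (a * u * X 0) = th 0%N (a * u)) ->
  (forall a n, (n < K)%N -> Phi (a * u * X n.+1) = th n.+1 (a * u) +
     \sum_(k < n.+1) Phi (a * u * emb (v k.+1) * u * X (n - k)%N)) ->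
  forall n a, (n <= K)%N ->
    Phi (a * u * X n) = \sum_(j < n.+1) th j (a * block (n - j)%N).
Proof.
move=> thD h0 hS; elim/ltn_ind => -[|n] IH a nK.
  by rewrite big_ord1 sub0n block0 h0.
have th_sum j (I : finType) (F : I -> A) : th j (\sum_i F i) = \sum_i th j (F i).
  have th0 : th j 0 = 0 by apply: (addrI (th j 0)); rewrite -thD !addr0.
  by elim/big_rec2: _ => [|i x y _ <-].
rewrite hS // [RHS]big_ord_recr /= subnn block0 addrC; congr (_ + _).
under eq_bigr => k _.
  rewrite IH; [|by rewrite ltnS leq_subr|by apply: leq_trans (leq_subr _ _) (ltnW nK)].
  rewrite -subSn; last by rewrite -ltnS ltn_ord.
  over.
rewrite (sum_triangle n.+1
  (fun k j => th j (a * u * emb (v k.+1) * block (n - k - j)%N))).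
apply: eq_bigr => j _; have jn : (j <= n)%N by rewrite -ltnS ltn_ord.
rewrite subSn // blockS mulr_sumr th_sum; apply: eq_bigr => k _.
by rewrite !mulrA subnAC.
Qed.

End Blocks.

Section Words.
Variables (U V : A) (z : B).
Hypothesis hUV : monotone_pair (U - 1) V.
Local Notation u := (U - 1).
Local Notation y := (fun k => (emb z * V) ^+ k).
Local Notation v := (fun k => Phi ((emb z * V) ^+ k)).
Local Notation P := (fun n => (emb z * (V * U)) ^+ n).

(** Splitting (zVU)^n at the first u, with U = 1 + u. *)
Lemma word_split n :
  P n.+1 = y n.+1 + \sum_(k < n.+1) y k.+1 * u * P (n - k)%N.
Proof.
have PS m : P m.+1 = y 1%N * P m + y 1%N * u * P m.
  by rewrite /= exprS expr1 -mulrDl -{1}[emb z * V]mulr1 -mulrDr [1 + _]addrC subrK !mulrA.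
elim: n => [|n IH]; first by rewrite big_ord1 /= subn0 PS /= expr0 !mulr1.
rewrite PS big_ord_recl /= subn0 [LHS]addrC [RHS]addrCA; congr (_ + _).
rewrite IH mulrDr -exprS mulr_sumr; congr (_ + _).
by apply: eq_bigr => k _; rewrite /bump add1n subSS !mulrA -exprS.
Qed.

(** Polarization of the factorization of y x y. *)
Lemma high_low_high_antisym x y1 y2 :
  gen_subalgebra emb u x -> gen_subalgebra emb V y1 -> gen_subalgebra emb V y2 ->
  Phi (y1 * x * y2) - Phi y1 * Phi x * Phi y2 =
  - (Phi (y2 * x * y1) - Phi y2 * Phi x * Phi y1).
Proof.
move=> gx g1 g2; apply/eqP; rewrite -addr_eq0; apply/eqP.
have := mp_high_low_high hUV gx (gen_add g1 g2).
rewrite !(condexpD hemb hPhi) !mulrDl !mulrDr !(condexpD hemb hPhi).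
rewrite !(mp_high_low_high hUV) // => h.
rewrite addrACA -opprD; apply/eqP; rewrite subr_eq0; apply/eqP.
move: h; rewrite -!addrA => /addrI; rewrite !addrA => /addIr.
by rewrite ?addrA.
Qed.

(** After expanding both sides into the parts y_k x y_l, with x a block, the
difference is a sum of the antisymmetric defects of y_k x y_l over all (k, l)
of fixed total degree; the terms with l = 0 have no defect. *)
Lemma moment_product_formula K (S : nat -> A) :
  S 0%N = 1 ->
  (forall n, (n < K)%N -> S n.+1 = emb (v n.+1) +
     \sum_(k < n.+1) emb (v k.+1) * u * S (n - k)%N) ->
  forall n, (n <= K)%N -> Phi (P n) = Phi (S n).
Proof.
move=> S0 SS [|n] nK; first by rewrite /= S0 expr0.
have expP := @block_expansion u v n.+1 P (fun j x => Phi (x * y j)) _ _ _.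
have expS := @block_expansion u v n.+1 S (fun j x => Phi x * v j) _ _ _.
have {}expP m a : (m <= n.+1)%N ->
    Phi (a * u * P m) = \sum_(j < m.+1) Phi (a * block u v (m - j)%N * y j).
  apply: expP => [j b c|b|b k _] /=.
  - by rewrite mulrDl (condexpD hemb hPhi).
  - by rewrite !expr0 !mulr1.
  - rewrite word_split mulrDr (condexpD hemb hPhi) mulr_sumr (condexp_sum hemb hPhi).
    congr (_ + _); apply: eq_bigr => i _.
    by rewrite !mulrA (mp_mid hUV (gen_exp _ _ _)).
have {}expS m a : (m <= n.+1)%N ->
    Phi (a * u * S m) = \sum_(j < m.+1) Phi (a * block u v (m - j)%N) * v j.
  apply: expS => [j b c|b|b k kn] /=.
  - by rewrite (condexpD hemb hPhi) mulrDl.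
  - by rewrite S0 expr0 (condexp1 hemb hPhi) !mulr1.
  - rewrite SS; last by apply: leq_trans kn nK.
    rewrite mulrDr (condexpD hemb hPhi) mulr_sumr (condexp_sum hemb hPhi).
    rewrite (condexpMr hemb hPhi); congr (_ + _).
    by apply: eq_bigr => i _; rewrite !mulrA.
rewrite /= word_split SS // !(condexpD hemb hPhi) (condexp_id hPhi).
congr (_ + _); rewrite !(condexp_sum hemb hPhi).
under eq_bigr => k _ do rewrite expP ?leqW ?leq_subr //.
under [RHS]eq_bigr => k _ do rewrite expS ?leqW ?leq_subr //.
apply/eqP; rewrite -subr_eq0 -sumrB; apply/eqP.
pose D k j := Phi (y k.+1 * block u v (n - k - j)%N * y j) -
              v k.+1 * Phi (block u v (n - k - j)%N) * v j.
rewrite (eq_bigr (fun k : 'I_n.+1 => \sum_(j < n - k) D k j.+1)) => [|k _].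
  rewrite big_ord_recr /= subnn big_ord0 addr0.
  apply: (sum_antisymmetric_triangle (F := fun k j => D k j.+1)) => k j kj.
  rewrite /D (_ : n - k - j.+1 = n - j - k.+1)%N; last by lia.
  apply: high_low_high_antisym; [exact: gen_block|exact: gen_exp|exact: gen_exp].
rewrite -sumrB big_ord_recl /= subn0 expr0 !mulr1 (condexp1 hemb hPhi) mulr1.
rewrite (mp_high_low hUV (gen_block _ _ _) (gen_exp _ _ _)) (condexpMl hemb hPhi).
rewrite subrr add0r; apply: eq_bigr => j _.
by rewrite /D /bump /= add1n (condexpMl hemb hPhi).
Qed.

End Words.
End MonotonePairs.

(** * Truncated resolvents *)

Section TruncatedGeometric.

(** Truncation of (1 + x)^-1 x. Only positive powers of x occur, so that the
non-unital embedding of B in A commutes with it. *)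
Definition quasi_inverse_trunc (S : nzRingType) K (x : S) : S := - \sum_(j < K) (- x) ^+ j.+1.

Lemma quasi_inverse_truncE (S : nzRingType) K (x : S) : (1 + x) * quasi_inverse_trunc K x = x + (- x) ^+ K.+1.
Proof.
elim: K => [|K IH]; first by rewrite /quasi_inverse_trunc big_ord0 oppr0 mulr0 expr1 subrr.
rewrite /quasi_inverse_trunc big_ord_recr /= opprD mulrDr -/(quasi_inverse_trunc K x) IH.
by rewrite mulrN mulrDl mul1r opprD addrA addrK -mulNr -exprS.
Qed.

Lemma coef_expr_low (S : nzRingType) (p : {poly S}) m i :
  p`_0 = 0 -> (i < m)%N -> (p ^+ m)`_i = 0.
Proof.
move=> p0; elim: m i => // m IH i im.
rewrite exprS coefM big1 // => -[[|j] /= ji] _; first by rewrite p0 mul0r.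
by rewrite IH ?mulr0 //; lia.
Qed.

Lemma coef_mul_low (S : nzRingType) (p q : {poly S}) m :
  (forall i, (i < m)%N -> p`_i = 0) ->
  forall i, (i < m)%N -> (p * q)`_i = 0 /\ (q * p)`_i = 0.
Proof.
move=> h i im; split; rewrite coefM big1 // => j _.
  by rewrite h ?mul0r //; apply: leq_trans (ltn_ord j) im.
by rewrite h ?mulr0 //; apply: leq_ltn_trans (leq_subr _ _) im.
Qed.

End TruncatedGeometric.

Section Composition.
Context (R : realType) (B : cstarAlgType R) (A : starAlgType R).
Context (emb : B -> A) (Phi : A -> B).
Hypotheses (hemb : star_embedding emb)
  (hPhi : positive_conditional_expectation emb Phi).
Local Notation nrm := (@nrm R B).
Local Notation moment := (moment emb Phi).
Local Notation growth := (moment_growth emb Phi).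
Implicit Types (x : A) (z : B).

(** The transform vartheta as a series in B, independent of the completion
of A. *)
Definition moment_sum x z : B :=
  limn (series (fun n => moment x n.+1 z : nspace B)).

Definition moment_kappa x z : B := (1 + moment_sum x z)^-1 * moment_sum x z.

Lemma partial_sum_bound x C L z K : 0 <= C -> 0 <= L -> growth x C L ->
  L * nrm z <= 2^-1 ->
  nrm (\sum_(k < K) moment x k.+1 z) <= 2 * C * (L * nrm z).
Proof.
move=> C0 L0 hx hz; apply: le_trans (nrm_sum _ _ _) _.
have q0 : 0 <= L * nrm z by rewrite mulr_ge0 ?nrm_ge0.
rewrite (@le_trans _ _ (\sum_(k < K) C * (L * nrm z) ^+ k.+1)) //.
  by apply: ler_sum => k _; apply: hx.
rewrite -mulr_sumr [2 * C]mulrC -mulrA ler_wpM2l //.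
have := sum_geometric_le K.+1 1 q0 hz.
by rewrite big_add1 big_mkord expr1.
Qed.

Lemma moment_sumE x C L z K : 0 <= C -> 0 <= L -> growth x C L -> L * nrm z <= 2^-1 ->
  nrm (\sum_(k < K) moment x k.+1 z - moment_sum x z) <= C * 2^-1 ^+ K.
Proof.
move=> C0 L0 hx hz; pose s n : B := \sum_(k < n) moment x k.+1 z.
have q0 : 0 <= L * nrm z by rewrite mulr_ge0 ?nrm_ge0.
have ds n : nrm (s n.+1 - s n) <= C / 2 * 2^-1 ^+ n.
  rewrite /s big_ord_recr /= addrAC subrr add0r -mulrA -exprS.
  apply: le_trans (hx _ _) _; rewrite ler_wpM2l // lerXn2r ?nnegrE ?invr_ge0 //.
have [l hl] := complete_geometric ds.
have {}hl n : nrm (s n - l) <= C * 2^-1 ^+ n.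
  by have := hl n; rewrite (_ : 2 * (C / 2) = C) //; field.
suff -> : moment_sum x z = l by exact: hl.
have H := cvg_geometric_limit hl.
rewrite /moment_sum (_ : series _ = (s : nat -> nspace B)).
  exact: (cvg_lim (@norm_hausdorff _ (nspace B)) H).
by apply/funext => n; rewrite /series /= big_mkord.
Qed.

Lemma moment_sum_bound x C L z : 0 <= C -> 0 <= L -> growth x C L -> L * nrm z <= 2^-1 ->
  nrm (moment_sum x z) <= 2 * C * (L * nrm z).
Proof.
move=> C0 L0 hx hz; rewrite -subr_le0; apply: (@le0_geometric _ _ C) => K.
have h1 := partial_sum_bound K C0 L0 hx hz; have h2 := moment_sumE K C0 L0 hx hz.
have := nrmB (\sum_(k < K) moment x k.+1 z) (\sum_(k < K) moment x k.+1 z - moment_sum x z).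
by rewrite opprB addrC subrK; lra.
Qed.

(** The bound makes 1 + moment_sum x z a unit. *)
Lemma moment_kappaE x z : nrm (moment_sum x z) <= 2^-1 -> (1 + moment_sum x z) * moment_kappa x z = moment_sum x z.
Proof. by move=> h; rewrite /moment_kappa mulrA mulrV ?mul1r //; apply: unit_near1. Qed.

(** Quantitative invertibility of 1 + v. *)
Lemma le_double_1D (v d : B) : nrm v <= 2^-1 -> nrm d <= 2 * nrm ((1 + v) * d).
Proof.
move=> hv; have e : nrm d = nrm ((1 + v) * d - v * d).
  by rewrite mulrDl mul1r addrK.
have := nrmB ((1 + v) * d) (v * d); rewrite -e.
have := nrmM v d; have := nrm_ge0 d; nra.
Qed.

Lemma moment_kappa_bound x z : nrm (moment_sum x z) <= 2^-1 -> nrm (moment_kappa x z) <= 2 * nrm (moment_sum x z).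
Proof.
by move=> h; have := le_double_1D (moment_kappa x z) h; rewrite moment_kappaE.
Qed.

Lemma quasi_inverse_trunc_bound K (x : B) (r : R) : nrm x <= r -> r <= 2^-1 -> nrm (quasi_inverse_trunc K x) <= 2 * r.
Proof.
move=> xr r2; have r0 : 0 <= r by apply: le_trans (nrm_ge0 _) xr.
rewrite /quasi_inverse_trunc nrmN; apply: le_trans (nrm_sum _ _ _) _.
rewrite (@le_trans _ _ (\sum_(j < K) r ^+ j.+1)) //.
  apply: ler_sum => j _; apply: le_trans (nrmX _ _) _.
  by rewrite nrmN lerXn2r ?nnegrE ?nrm_ge0.
by have := sum_geometric_le K.+1 1 r0 r2; rewrite big_add1 big_mkord expr1.
Qed.

Lemma emb_quasi_inverse_trunc K (x : B) : emb (quasi_inverse_trunc K x) = quasi_inverse_trunc K (emb x).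
Proof.
rewrite /quasi_inverse_trunc (embN hemb) (emb_sum hemb); congr (- _); apply: eq_bigr => j _.
by rewrite (embX hemb) (embN hemb).
Qed.

(** The Lipschitz estimate on lines of radius 1/(4L|d|), chosen so that the whole
line stays where the moments decay like 2^-k. *)
Lemma moment_perturbation x C L (w d : B) K : 0 <= C -> 1 <= L -> growth x C L ->
  L * nrm w <= 4^-1 -> L * nrm d <= 8^-1 ->
  nrm (\sum_(k < K) moment x k.+1 (w + d) - \sum_(k < K) moment x k.+1 w) <=
  16 * C * L * nrm d.
Proof.
move=> C0 L1 hx hw hd.
have [d0|dn] := eqVneq (nrm d) 0.
  by rewrite (nrm_eq0 d0) addr0 subrr nrm0 mulr0.
have dp : 0 < nrm d by rewrite lt_def dn nrm_ge0.
have Lp : 0 < L by lra.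
(* With this radius L |t d| = 1/4, so that L |w + t d| <= 1/2 on |t| = r. *)
have [r rE] : exists r : R, r = (4 * L * nrm d)^-1 by eexists.
have r2 : 2 <= r.
  rewrite rE -[2]invrK lef_pV2 ?posrE ?invr_gt0 // ?mulr_gt0 //.
  by rewrite -mulrA; lra.
have rd : L * (r * nrm d) = 4^-1 by rewrite rE; field; rewrite dn gt_eqF.
have step k : nrm (moment x k.+1 (w + d) - moment x k.+1 w) <=
    8 * C * L * nrm d * 2^-1 ^+ k.
  have -> : 8 * C * L * nrm d * 2^-1 ^+ k = 2 * (C * 2^-1 ^+ k) / r.
    by rewrite rE invrK; ring.
  apply: (moment_line hemb hPhi) => // t tr; apply: le_trans (hx _ _) _.
  rewrite ler_wpM2l // (@le_trans _ _ (2^-1 ^+ k.+1)) //; last first.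
    by rewrite ler_wiXn2l // ?invr_ge0 // invf_le1 // ler1n.
  rewrite lerXn2r ?nnegrE ?invr_ge0 ?mulr_ge0 ?nrm_ge0 ?(ltW Lp) //.
  have := nrmD w (t *: d); rewrite nrmZ tr => h.
  have := ler_wpM2l (ltW Lp) h; rewrite mulrDr rd; lra.
rewrite -sumrB; apply: le_trans (nrm_sum _ _ _) _.
rewrite (@le_trans _ _ (\sum_(k < K) 8 * C * L * nrm d * 2^-1 ^+ k)) //.
  by apply: ler_sum => k _; apply: step.
rewrite -mulr_sumr.
have := sum_geometric_le K 0 (_ : 0 <= 2^-1 :> R) (lexx _).
rewrite big_mkord expr0 mulr1 invr_ge0 ler0n => /(_ isT) h.
have p : 0 <= 8 * C * L * nrm d by rewrite !mulr_ge0 // ltW.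
by have := ler_wpM2l p h; lra.
Qed.

Section Truncation.
Variables (U V : A) (z : B) (K : nat).
Local Notation u := (U - 1).
Local Notation v k := (moment V k z).

(** The truncations of vartheta_V(tz), kappa_V(tz) and of the resolvent of
kappa_V(tz) U, as polynomials in t. *)
Definition vpoly : {poly A} :=
  \poly_(k < K.+1) (if k is _.+1 then emb (v k) else 0).
Definition wpoly : {poly A} := quasi_inverse_trunc K vpoly.
Definition resolvent : {poly A} := \sum_(n < K.+1) (wpoly * U%:P) ^+ n.

(** The value of vpoly at t, as an element of B. *)
Definition vpart (t : R[i]) : B := \sum_(k < K) moment V k.+1 (t *: z).

Lemma eval_vpoly t : vpoly.[t%:A] = emb (vpart t).
Proof.
rewrite horner_poly big_ord_recl mul0r add0r (emb_sum hemb).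
apply: eq_bigr => k _ /=; rewrite ?add1n (momentZ hemb hPhi) (embZ hemb).
by rewrite exprZn expr1n mulr_algr.
Qed.

Lemma eval_wpoly t : wpoly.[t%:A] = emb (quasi_inverse_trunc K (vpart t)).
Proof.
rewrite /wpoly /quasi_inverse_trunc hornerN horner_sum emb_quasi_inverse_trunc; congr (- _).
by apply: eq_bigr => j _; rewrite eval_scalarX hornerN eval_vpoly.
Qed.

Lemma condexp_resolvent t :
  Phi resolvent.[t%:A] = \sum_(n < K.+1) moment U n (quasi_inverse_trunc K (vpart t)).
Proof.
rewrite /resolvent horner_sum (condexp_sum hemb hPhi).
by apply: eq_bigr => n _; rewrite eval_scalarX eval_scalarM eval_wpoly hornerC.
Qed.

Lemma vpoly0 : vpoly`_0 = 0. Proof. by rewrite coef_poly. Qed.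

(** Modulo t^(K+1): with F the resolvent, F = 1 + w U F and (1 + v) w = v, so
(1 + v) F = 1 + v + v U F, and U = 1 + u cancels v F. *)
Lemma resolventE : exists2 E : {poly A},
  forall i, (i < K.+1)%N -> E`_i = 0 &
  resolvent = 1 + vpoly + vpoly * (u%:P * resolvent) + E.
Proof.
pose T := wpoly * U%:P.
have w0 : wpoly`_0 = 0.
  rewrite /wpoly /quasi_inverse_trunc coefN coef_sum big1 ?oppr0 // => j _.
  by rewrite coef_expr_low // coefN vpoly0 oppr0.
have T0 : T`_0 = 0 by rewrite coefMC w0 mul0r.
have FE : resolvent = 1 + T * resolvent - T ^+ K.+1.
  have := subrX1 T K.+1; rewrite -/resolvent mulrBl mul1r => h.
  have -> : T * resolvent = T ^+ K.+1 - 1 + resolvent by rewrite h subrK.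
  by rewrite addrA addrCA subrr addr0 addrC addrK.
have VW : (1 + vpoly) * wpoly = vpoly + (- vpoly) ^+ K.+1 by apply: quasi_inverse_truncE.
exists ((- vpoly) ^+ K.+1 * (U%:P * resolvent) - (1 + vpoly) * T ^+ K.+1).
  move=> i iK; rewrite coefB.
  have h1 j : (j < K.+1)%N -> ((- vpoly) ^+ K.+1)`_j = 0.
    by move=> jK; rewrite coef_expr_low // coefN vpoly0 oppr0.
  have h2 j : (j < K.+1)%N -> (T ^+ K.+1)`_j = 0 by move=> jK; rewrite coef_expr_low.
  by rewrite (coef_mul_low _ h1 iK).1 (coef_mul_low _ h2 iK).2 subr0.
have H : (1 + vpoly) * resolvent = (1 + vpoly) +
    (vpoly + (- vpoly) ^+ K.+1) * (U%:P * resolvent) - (1 + vpoly) * T ^+ K.+1.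
  by rewrite {1}FE !mulrDr mulr1 mulrN -VW /T !mulrA.
apply: (addIr (vpoly * resolvent)).
have -> : vpoly * (u%:P * resolvent) = vpoly * (U%:P * resolvent) - vpoly * resolvent.
  by rewrite polyCB polyC1 mulrBl mul1r mulrBr.
rewrite -[X in X + _ = _]mul1r -mulrDl H [(vpoly + _) * _]mulrDl.
by rewrite [RHS]addrAC -[X in X + (_ - _)]addrA subrK !addrA.
Qed.

Lemma coef_resolvent : resolvent`_0 = 1 /\ (forall n, (n < K)%N ->
  resolvent`_n.+1 = emb (v n.+1) +
    \sum_(k < n.+1) emb (v k.+1) * u * resolvent`_(n - k)).
Proof.
have [E hE RE] := resolventE; split.
  rewrite {1}RE !coefD coef1 hE // vpoly0 coefM big_ord1 vpoly0.
  by rewrite mul0r !addr0.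
move=> n nK; rewrite {1}RE !coefD coef1 hE // addr0 add0r coef_poly ltnS nK.
congr (_ + _); rewrite coefM big_ord_recl vpoly0 mul0r add0r.
apply: eq_bigr => k _ /=; rewrite ?add1n subSS coefCM coef_poly ltnS mulrA.
by rewrite (leq_trans (ltn_ord k)).
Qed.

End Truncation.
End Composition.

(** * Composition of the moment series *)

Section CompositionTheorem.
Context (R : realType) (B : cstarAlgType R) (A : starAlgType R).
Context (emb : B -> A) (Phi : A -> B).
Hypotheses (hemb : star_embedding emb)
  (hPhi : positive_conditional_expectation emb Phi).
Local Notation nrm := (@nrm R B).
Local Notation moment := (moment emb Phi).
Local Notation growth := (moment_growth emb Phi).
Local Notation moment_sum := (moment_sum emb Phi).
Local Notation moment_kappa := (moment_kappa emb Phi).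

Section Estimates.
Variables (U V : A) (C L : R) (z : B).
Hypotheses (C1 : 1 <= C) (L1 : 1 <= L)
  (gU : growth U C L) (gV : growth V C L) (gVU : growth (V * U) C L)
  (small_z : 128 * (C * L * (L * nrm z)) <= 1).

Local Notation q := (L * nrm z).
Local Notation r := (4 * C * q).

Let small_facts : [/\ 0 <= C, 0 <= L, 0 <= q, q <= C * q & C * q <= C * L * q] /\
  [/\ 128 * (C * L * q) <= 1, L * (2 * r) <= 16^-1 & 1 <= L].
Proof.
have C0 : 0 <= C := le_trans ler01 C1; have L0 : 0 <= L := le_trans ler01 L1.
have q0 : 0 <= q by rewrite mulr_ge0 ?nrm_ge0.
have sz := small_z; do 2!split=> //.
- by rewrite -{1}[q]mul1r ler_wpM2r.
- by rewrite ler_wpM2r // -{1}[C]mulr1 ler_wpM2l.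
- by rewrite (_ : L * (2 * r) = 8 * (C * L * q)); [lra|ring].
Qed.

Lemma vpart_bound K t : cmod t <= 2 -> nrm (vpart emb Phi V z K t) <= r.
Proof.
have [[C0 L0 q0 Cq CLq] [sz Lr L1']] := small_facts.
move=> t2; have e : L * nrm (t *: z) <= 2 * q.
  by rewrite nrmZ mulrCA; apply: ler_wpM2r.
apply: le_trans (partial_sum_bound K C0 L0 gV (z := t *: z) _) _; first by lra.
by have := ler_wpM2l C0 e; lra.
Qed.

(** On |t| = 2 the truncated kappa_V(tz) stays small enough for the moments of U
to decay geometrically, so the tail bound applies with r = 2. *)
Lemma resolvent_tail K :
  nrm (Phi (resolvent emb Phi U V z K).[1] -
       \sum_(k < K.+1) Phi (resolvent emb Phi U V z K)`_k) <=
  4 * C * 2^-1 ^+ K.+1.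
Proof.
have [[C0 L0 q0 Cq CLq] [sz Lr L1']] := small_facts.
have := @condexp_tail_bound _ _ _ _ _ hemb hPhi (resolvent emb Phi U V z K)
  2 (2 * C) (lexx _) _ K.+1.
rewrite mulrA -(natrM _ 2 2); apply=> t t2.
rewrite (condexp_resolvent hemb hPhi); apply: le_trans (nrm_sum _ _ _) _.
rewrite (@le_trans _ _ (\sum_(n < K.+1) C * 2^-1 ^+ n)) //.
  apply: ler_sum => n _; apply: le_trans (gU _ _) _.
  rewrite ler_wpM2l // lerXn2r ?nnegrE ?invr_ge0 ?mulr_ge0 ?nrm_ge0 //.
  have vb : nrm (vpart emb Phi V z K t) <= r by rewrite vpart_bound ?t2.
  have := quasi_inverse_trunc_bound K vb _; rewrite (_ : r <= 2^-1); last by lra.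
  by move=> /(_ isT) h; have := ler_wpM2l L0 h; lra.
rewrite -mulr_sumr [2 * C]mulrC ler_wpM2l //.
have := @sum_geometric_le R 2^-1 K.+1 0.
by rewrite big_mkord expr0 mulr1; apply; rewrite ?invr_ge0.
Qed.

Lemma moment_sum_small : nrm (moment_sum V z) <= r.
Proof.
have [[C0 L0 q0 Cq CLq] [sz Lr L1']] := small_facts.
apply: le_trans (moment_sum_bound C0 L0 gV _) _; first by lra.
by have h := mulr_ge0 C0 q0; lra.
Qed.

Lemma moment_kappa_small : nrm (moment_kappa V z) <= 2 * r.
Proof.
have [[C0 L0 q0 Cq CLq] [sz Lr L1']] := small_facts.
have h := moment_sum_small.
by apply: le_trans (moment_kappa_bound _) _; lra.
Qed.

(** Both elements are compared after multiplication by 1 + vartheta_V(z). *)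
Lemma quasi_inverse_trunc_close K :
  nrm (quasi_inverse_trunc K (vpart emb Phi V z K 1) - moment_kappa V z) <= (4 * C + 2) * 2^-1 ^+ K.
Proof.
have [[C0 L0 q0 Cq CLq] [sz Lr L1']] := small_facts.
have h := moment_sum_small.
have vb : nrm (vpart emb Phi V z K 1) <= r by rewrite vpart_bound // cmod1 ler1n.
have vm : nrm (vpart emb Phi V z K 1 - moment_sum V z) <= C * 2^-1 ^+ K.
  by rewrite /vpart scale1r; apply: moment_sumE gV _ => //; lra.
have rh : r <= 2^-1 by lra.
have gb := quasi_inverse_trunc_bound K vb rh.
rewrite nrmBC; apply: le_trans (le_double_1D (v := moment_sum V z) _ _) _; first by lra.
move: (vpart _ _ _ _ _ _) vb vm gb => vK vb vm gb.
have -> : (1 + moment_sum V z) * (moment_kappa V z - quasi_inverse_trunc K vK) =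
    (moment_sum V z - vK) - (- vK) ^+ K.+1 + (vK - moment_sum V z) * quasi_inverse_trunc K vK.
  rewrite mulrBr moment_kappaE; last by lra.
  have -> : (1 + moment_sum V z) * quasi_inverse_trunc K vK =
            (1 + vK) * quasi_inverse_trunc K vK - (vK - moment_sum V z) * quasi_inverse_trunc K vK.
    by rewrite -mulrBl opprB addrACA subrr addr0.
  by rewrite quasi_inverse_truncE opprB addrCA [LHS]addrC opprD !addrA.
have p : 0 <= 2^-1 ^+ K :> R by rewrite exprn_ge0 // invr_ge0.
have h1 := nrmD ((moment_sum V z - vK) - (- vK) ^+ K.+1) ((vK - moment_sum V z) * quasi_inverse_trunc K vK).
have h2 := nrmB (moment_sum V z - vK) ((- vK) ^+ K.+1).
have h3 : nrm ((- vK) ^+ K.+1) <= 2^-1 ^+ K.+1.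
  apply: le_trans (nrmX _ _) _; rewrite nrmN lerXn2r ?nnegrE ?nrm_ge0 ?invr_ge0 //.
  by lra.
have h4 := nrmM (vK - moment_sum V z) (quasi_inverse_trunc K vK).
have h5 : nrm (vK - moment_sum V z) * nrm (quasi_inverse_trunc K vK) <= C * 2^-1 ^+ K * 1.
  by apply: ler_pM; rewrite ?nrm_ge0 //; lra.
rewrite [nrm (moment_sum V z - _)]nrmBC in h2; rewrite [X in _ <= X]exprS in h3.
by lra.
Qed.

(** Both sums are within O(2^-K) of the truncated ones, for every K: the moments
of VU of degree at most K are the coefficients of the resolvent, whose value
at t = 1 is a partial sum of moments of U at the truncated kappa_V(z). *)
Lemma moment_sum_composition : monotone_pair emb Phi (U - 1) V ->
  moment_sum (V * U) z = moment_sum U (moment_kappa V z).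
Proof.
have [[C0 L0 q0 Cq CLq] [sz Lr L1']] := small_facts.
move=> hUV; have hs := moment_sum_small; have hk := moment_kappa_small.
have rb : r <= 32^-1 by lra.
have Lk : L * nrm (moment_kappa V z) <= 16^-1 by have := ler_wpM2l L0 hk; lra.
(* The four errors in the comparison of both sides through the partial sums
   sVU, sK and s. *)
pose D := C + 2 * C + 16 * C * L * (4 * C + 2) + C.
apply: (@eq_geometric _ _ _ _ D) => K.
set w := moment_kappa V z; set wK := quasi_inverse_trunc K (vpart emb Phi V z K 1).
pose sVU : B := \sum_(k < K) moment (V * U) k.+1 z.
pose sK : B := \sum_(k < K) moment U k.+1 wK.
pose s : B := \sum_(k < K) moment U k.+1 w.
have b1 : nrm (sVU - moment_sum (V * U) z) <= C * 2^-1 ^+ K.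
  by apply: moment_sumE gVU _ => //; lra.
have b4 : nrm (s - moment_sum U w) <= C * 2^-1 ^+ K.
  by apply: moment_sumE gU _ => //; lra.
have b2 : nrm (sK - sVU) <= 2 * C * 2^-1 ^+ K.
  have [S0 SS] := coef_resolvent emb Phi U V z K.
  have := resolvent_tail K.
  have -> : Phi (resolvent emb Phi U V z K).[1] = 1 + sK.
    rewrite -[1](scale1r (1 : A)) (condexp_resolvent hemb hPhi) big_ord_recl.
    by rewrite (moment0 hemb hPhi).
  have -> : \sum_(k < K.+1) Phi (resolvent emb Phi U V z K)`_k = 1 + sVU.
    rewrite big_ord_recl S0 (condexp1 hemb hPhi); congr (_ + _).
    apply: eq_bigr => k _ /=; rewrite ?add1n.
    by rewrite -(moment_product_formula hemb hPhi hUV S0 SS).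
  by rewrite opprD addrACA subrr add0r exprS; lra.
have b3 : nrm (sK - s) <= 16 * C * L * (4 * C + 2) * 2^-1 ^+ K.
  have hd := quasi_inverse_trunc_close K; rewrite -/w -/wK in hd.
  have vb : nrm (vpart emb Phi V z K 1) <= r by rewrite vpart_bound // cmod1 ler1n.
  have wKb : nrm wK <= 2 * r by apply: quasi_inverse_trunc_bound => //; lra.
  have wKE : wK = w + (wK - w) by rewrite addrC subrK.
  rewrite /sK wKE.
  apply: le_trans (moment_perturbation hemb hPhi K C0 L1 gU _ _) _.
  - by apply: le_trans Lk _; lra.
  - have := nrmB wK w; have := ler_wpM2l L0 wKb.
    rewrite -/w in Lk => h1 h2; have := ler_wpM2l L0 h2; rewrite mulrDr; lra.
  - by rewrite -[X in _ <= X]mulrA ler_wpM2l // !mulr_ge0.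
have h1 := nrm_triangle sVU (moment_sum (V * U) z) (moment_sum U w).
have h2 := nrm_triangle sK sVU (moment_sum U w).
have h3 := nrm_triangle s sK (moment_sum U w).
rewrite nrmBC in b1; rewrite nrmBC in b2.
by rewrite /D; lra.
Qed.

End Estimates.
End CompositionTheorem.

(** * Monotone pairs from independence, and their adjoints *)

Section Independence.
Context (R : realType) (B : cstarAlgType R) (A : starAlgType R).
Context (emb : B -> A) (Phi : A -> B).
Hypotheses (hemb : star_embedding emb)
  (hPhi : positive_conditional_expectation emb Phi).
Local Notation gen := (gen_subalgebra emb).

Lemma gen_star x y : gen (star x) y -> gen x (star y).
Proof.
elim=> [|a b _ IHa _ IHb|c a _ IHa|a b _ IHa _ IHb|b a _ IHa|b a _ IHa].
- by rewrite starK; apply: gen_base.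
- by rewrite starD; apply: gen_add.
- by rewrite starZ; apply: gen_scale.
- by rewrite starM; apply: gen_mul.
- by rewrite starM -(emb_star hemb); apply: gen_mulr.
- by rewrite starM -(emb_star hemb); apply: gen_mull.
Qed.

(** The involution reverses products: it exchanges the clauses for x y and y x and
preserves the other two. *)
Lemma monotone_pair_star u v :
  monotone_pair emb Phi u v -> monotone_pair emb Phi (star u) (star v).
Proof.
move=> [mid lh hl hlh]; have PS := condexp_star hemb hPhi.
split=> [y gy a b|x y gx gy|x y gx gy|x y gx gy]; apply: (can_inj (@starK _ B)).
- have := mid _ (gen_star gy) (star b) (star a).
  by rewrite -!PS !starM !starK -(emb_star hemb) -!PS !mulrA.
- by rewrite -PS starM (hl _ _ (gen_star gx) (gen_star gy)); rewrite starM !PS.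
- by rewrite -PS starM (lh _ _ (gen_star gx) (gen_star gy)); rewrite starM !PS.
- by rewrite -PS !starM mulrA (hlh _ _ (gen_star gx) (gen_star gy)); rewrite !PS mulrA.
Qed.

Lemma monotone_pair_of_independent u v :
  monotonically_independent_elements emb Phi
    (fun j : 'I_2 => if j == ord0 then u else v) ->
  monotone_pair emb Phi u v.
Proof.
move=> h; pose o1 : 'I_2 := ord_max.
have lt01 : (ord0 < o1)%O by [].
have G x y : gen u x -> gen v y -> forall j : 'I_2,
    gen (if j == ord0 then u else v) (if j == ord0 then x else y).
  by move=> gx gy j; case: eqP.
have H x y gx gy := h (fun j : 'I_2 => if j == ord0 then x else y) (@G x y gx gy).
split=> [y gy a b|x y gx gy|x y gx gy|x y gx gy].
- have [mid _] := H _ _ (gen_base emb u) gy.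
  by have := mid ord0 o1 ord0 lt01 lt01 a b.
- have [_ bdry] := H _ _ gx gy.
  have [_ _] := bdry ord0 [::] [:: o1] isT isT.
  by rewrite !big_seq1.
- have [_ bdry] := H _ _ gx gy.
  have [+ _ _] := bdry ord0 [:: o1] [::] isT isT.
  by rewrite (_ : rev _ = [:: o1; ord0]) // !big_cons !big_nil !mulr1.
- have [_ bdry] := H _ _ gx gy.
  have [_ _] := bdry ord0 [:: o1] [:: o1] isT isT.
  by rewrite (_ : rev _ = [:: o1; ord0]) // !big_cons !big_nil !mulr1.
Qed.

End Independence.

(** * The transforms as sums of moment series *)

Section Transforms.
Context (R : realType) (B : cstarAlgType R) (A : starAlgType R).
Context (emb : B -> A) (Phi : A -> B).
Hypotheses (hemb : star_embedding emb)
  (hPhi : positive_conditional_expectation emb Phi).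
Context (Abar : completeNormedModType R[i]) (iota : A -> Abar)
  (Phibar : Abar -> nspace B).
Hypothesis hcl : closure_extension Phi iota Phibar.
Local Notation nrm := (@nrm R B).
Local Notation moment := (moment emb Phi).
Local Notation moment_sum := (moment_sum emb Phi).
Local Notation moment_kappa := (moment_kappa emb Phi).
Implicit Types (X U V : A) (z : B).

Lemma near0P (P : nspace B -> Prop) :
  (\forall z \near (0 : nspace B), P z) <->
  exists2 r : R, 0 < r & forall z : B, nrm z < r -> P z.
Proof.
have nE (z : B) : `|(0 : nspace B) - (z : nspace B)| = (nrm z)%:C%C.
  by rewrite sub0r normrN; exact: cnormE.
split=> [/nbhs_ballP [e /= e0 he]|[r r0 hr]].
  have re : e = (complex.Re e)%:C%C by rewrite RRe_real // gtr0_real.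
  exists (complex.Re e); first by rewrite -ltcR -re.
  by move=> z zr; apply: he; rewrite -ball_normE /ball_ /= nE re ltcR.
apply/nbhs_ballP; exists r%:C%C => /=; first by rewrite ltcR.
by move=> z; rewrite -ball_normE /ball_ /= nE ltcR; apply: hr.
Qed.

Definition moments_bounded X :=
  exists2 r : R, 0 < r &
    forall z, nrm z < r -> exists C, forall n, nrm (moment X n z) <= C.

Lemma moment_growth_le X (C L C' L' : R) : 0 <= C -> 0 <= L -> C <= C' -> L <= L' ->
  moment_growth emb Phi X C L -> moment_growth emb Phi X C' L'.
Proof.
move=> C0 L0 CC LL h n z; apply: le_trans (h n z) _.
apply: ler_pM => //; first by rewrite exprn_ge0 // mulr_ge0 ?nrm_ge0.
have L0' := le_trans L0 LL.
by rewrite lerXn2r ?nnegrE ?mulr_ge0 ?nrm_ge0 // ler_wpM2r ?nrm_ge0.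
Qed.

(** The bound by e keeps kappa_V(z) in the region where a transform of U is
given by its moments. *)
Lemma moment_kappa_composition U V (e : R) : 0 < e ->
  monotone_pair emb Phi (U - 1) V ->
  moments_bounded U -> moments_bounded V -> moments_bounded (V * U) ->
  exists2 r, 0 < r & forall z, nrm z < r ->
    moment_kappa (V * U) z = moment_kappa U (moment_kappa V z) /\ nrm (moment_kappa V z) < e.
Proof.
move=> e0 hUV [rU rU0 bU] [rV rV0 bV] [rW rW0 bW].
have [CU [LU [CU1 LU1 gU]]] := moment_growth_of_bounded hemb hPhi hcl rU0 bU.
have [CV [LV [CV1 LV1 gV]]] := moment_growth_of_bounded hemb hPhi hcl rV0 bV.
have [CW [LW [CW1 LW1 gW]]] := moment_growth_of_bounded hemb hPhi hcl rW0 bW.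
have [C CE] : exists C, C = CU + CV + CW by eexists.
have [L LE] : exists L, L = LU + LV + LW by eexists.
have C1 : 1 <= C by lra.
have L1 : 1 <= L by lra.
have {}gU : moment_growth emb Phi U C L by apply: moment_growth_le gU; lra.
have {}gV : moment_growth emb Phi V C L by apply: moment_growth_le gV; lra.
have {}gW : moment_growth emb Phi (V * U) C L by apply: moment_growth_le gW; lra.
have c0 : 0 < 128 * C * L * L by rewrite !mulr_gt0 //; lra.
exists (Num.min (1 / (128 * C * L * L)) (e / (128 * C * L * L))).
  by rewrite lt_min !divr_gt0.
move=> z; rewrite lt_min !ltr_pdivlMr // => /andP[z1 z2].
have sz : 128 * (C * L * (L * nrm z)) <= 1.
  by rewrite (_ : _ * _ = nrm z * (128 * C * L * L)) ?(ltW z1) //; ring.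
split; first by rewrite /moment_kappa (moment_sum_composition hemb hPhi C1 L1 gU gV gW sz hUV).
have ks := moment_kappa_small C1 L1 gV sz.
apply: le_lt_trans ks (le_lt_trans _ z2).
rewrite (_ : 2 * _ = C * L * nrm z * 8); last by ring.
rewrite (_ : nrm z * _ = C * L * nrm z * (128 * L)); last by ring.
rewrite ler_wpM2l ?mulr_ge0 ?nrm_ge0 //; lra.
Qed.

Lemma iota_series (a : nat -> A) n :
  Phibar (series (fun k => iota (a k)) n) = series (fun k => Phi (a k) : nspace B) n.
Proof.
have i0 : iota 0 = 0 by apply: (addrI (iota 0)); rewrite -(Defs.iotaD hcl) !addr0.
rewrite /series /= -(big_morph iota (Defs.iotaD hcl) i0) (PhibarE hcl).
exact: (condexp_sum hemb hPhi).
Qed.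

(** Continuity of Phibar transports convergence from Abar to B. *)
Lemma cvg_condexp_series (a : nat -> A) :
  cvgn (series (fun k => iota (a k))) ->
  series (fun k => Phi (a k) : nspace B) @ \oo -->
    Phibar (limn (series (fun k => iota (a k)))).
Proof.
move=> ca; rewrite (_ : series _ = Phibar \o series (fun k => iota (a k))).
  by apply: continuous_cvg => //; exact: (Phibar_continuous hcl).
by apply/funext => n; rewrite /= iota_series.
Qed.

Lemma cvg_series_shift (a : nat -> A) :
  cvgn (series (fun k => iota (a k))) -> cvgn (series (fun k => iota (a k.+1))).
Proof.
move=> ca.
rewrite (_ : series _ = (fun n => series (fun k => iota (a k)) n.+1 - iota (a 0%N))).
  apply: is_cvgB; last exact: is_cvg_cst.
  by apply/cvg_ex; exists (limn (series (fun k => iota (a k)))); rewrite cvg_shiftS.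
by apply/funext => n; rewrite /series /= big_nat_recl // addrAC subrr add0r.
Qed.

Lemma condexp_terms_bounded (a : nat -> A) :
  cvgn (series (fun k => iota (a k))) -> exists C, forall n, nrm (Phi (a n)) <= C.
Proof.
move=> /cvg_condexp_series h; set l := Phibar _ in h.
have [N hN] := nrm_cvg h ltr01.
exists (\sum_(k < N) nrm (Phi (a k)) + 2) => n.
have [nN|nN] := ltnP n N.
  rewrite (bigD1 (Ordinal nN)) //= -addrA lerDl addr_ge0 //.
  by apply: sumr_ge0 => k _; exact: nrm_ge0.
apply: (@le_trans _ _ 2); last by rewrite lerDr sumr_ge0 // => k _; exact: nrm_ge0.
have h1 := hN n nN; have h2 := hN n.+1 (leqW nN).
have -> : Phi (a n) = series (fun k => Phi (a k) : nspace B) n.+1 - series (fun k => Phi (a k) : nspace B) n.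
  by rewrite /series /= big_nat_recr //= addrAC subrr add0r.
apply: le_trans (nrm_triangle (l : B) _ _) _.
by rewrite [nrm (_ - series _ _)]nrmBC; lra.
Qed.

Lemma vartheta_moments_bounded X : vartheta_defined emb iota X -> moments_bounded X.
Proof.
move=> /near0P [r r0 hr]; exists r => // z zr.
exact: condexp_terms_bounded (hr z zr).
Qed.

Lemma varthetaE X z : cvgn (series (fun n => iota ((emb z * X) ^+ n))) ->
  vartheta emb iota Phibar X z = moment_sum X z.
Proof.
move=> /cvg_series_shift /cvg_condexp_series h.
rewrite /vartheta /moment_sum; under eq_fun do rewrite -exprSr.
by rewrite (cvg_lim (@norm_hausdorff _ (nspace B)) h).
Qed.

Lemma kappaE X z : cvgn (series (fun n => iota ((emb z * X) ^+ n))) ->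
  kappa emb iota Phibar X z = moment_kappa X z.
Proof. by move=> h; rewrite /kappa varthetaE. Qed.

Lemma moment_star X n z :
  Phi ((X * emb z) ^+ n) = star (moment (star X) n (star z)).
Proof.
by rewrite /moment -(condexp_star hemb hPhi) starX starM starK -(emb_star hemb) starK.
Qed.

Lemma varrho_moments_bounded X :
  varrho_defined emb iota X -> moments_bounded (star X).
Proof.
move=> /near0P [r r0 hr]; exists r => // z zr.
have [|C hC] := condexp_terms_bounded (hr (star z) _); first by rewrite nrm_star.
by exists C => n; rewrite -nrm_star -[z]starK -moment_star hC.
Qed.

(** Adjoints reverse words, turning (Xz)^n into (z^* X^* )^n, and the involution
is isometric on B. *)
Lemma varrhoE X z : cvgn (series (fun n => iota ((X * emb z) ^+ n))) ->
  varrho emb iota Phibar X z = star (moment_sum (star X) (star z)).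
Proof.
move=> /cvg_series_shift /cvg_condexp_series.
rewrite /varrho.
have -> : (fun n => iota (X * emb z * (X * emb z) ^+ n)) =
          (fun n => iota ((X * emb z) ^+ n.+1)).
  by apply/funext => n; rewrite exprS.
set l := Phibar _ => h; rewrite -[l in LHS](@starK _ B); congr star.
rewrite /moment_sum; apply/esym.
apply: (cvg_lim (@norm_hausdorff _ (nspace B))).
apply/cvgrPdist_lt => e e0; move/cvgrPdist_lt: h => /(_ e e0).
apply: filterS => n; congr (_ < _).
have E (b c : B) : `|(b : nspace B) - (c : nspace B)| = (nrm (b - c))%:C%C.
  exact: cnormE.
rewrite !E -nrm_star starD starN; congr (nrm (_ - _))%:C%C.
rewrite /series /= star_sum; apply: eq_bigr => k _.
by rewrite moment_star starK.
Qed.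

Lemma starV (b : B) : star b^-1 = (star b)^-1.
Proof.
have U (c : B) : c \is a GRing.unit -> star c \is a GRing.unit.
  move=> uc; apply/unitrP; exists (star c^-1).
  by rewrite -!starM mulrV // mulVr // star1.
have [ub|nub] := boolP (b \is a GRing.unit).
  apply: (mulrI (U _ ub)); rewrite mulrV ?U // -starM mulVr // star1 //.
by rewrite !invr_out //; apply: contra nub => /U; rewrite starK.
Qed.

Lemma rhoE X z : cvgn (series (fun n => iota ((X * emb z) ^+ n))) ->
  rho emb iota Phibar X z = star (moment_kappa (star X) (star z)).
Proof.
by move=> h; rewrite /rho varrhoE // /moment_kappa starM starV starD star1.
Qed.

End Transforms.

(** Near 0 each transform is given by its moments, so both identities are
instances of moment_kappa_composition: for (U, V) directly, and for the adjoint
pair (U^* , V^* ) at z^* after taking adjoints. *)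
Theorem theorem3p4 (R : realType) (B : cstarAlgType R) (A : starAlgType R)
    (emb : B -> A) (Phi : A -> B)
    (Abar : completeNormedModType R[i]) (iota : A -> Abar) (Phibar : Abar -> nspace B)
    (U V : A) :
  star_embedding emb ->
  positive_conditional_expectation emb Phi ->
  closure_extension Phi iota Phibar ->
  monotonically_independent_elements emb Phi
    (fun j : 'I_2 => if j == ord0 then U - 1 else V) ->
  (vartheta_defined emb iota U -> vartheta_defined emb iota V ->
   vartheta_defined emb iota (V * U) ->
   \forall z \near (0 : nspace B),
     kappa emb iota Phibar (V * U) z =
     (kappa emb iota Phibar U \o kappa emb iota Phibar V) z) /\
  (varrho_defined emb iota U -> varrho_defined emb iota V ->
   varrho_defined emb iota (U * V) ->
   \forall z \near (0 : nspace B),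
     rho emb iota Phibar (U * V) z =
     (rho emb iota Phibar U \o rho emb iota Phibar V) z).
Proof.
move=> hemb hPhi hcl /monotone_pair_of_independent hUV.
split=> [dU dV dVU|dU dV dUV].
  have [rU rU0 hU] := (near0P _).1 dU.
  have [rV rV0 hV] := (near0P _).1 dV.
  have [rW rW0 hW] := (near0P _).1 dVU.
  have [r r0 hr] := moment_kappa_composition hemb hPhi hcl rU0 hUV
    (vartheta_moments_bounded hemb hPhi hcl dU)
    (vartheta_moments_bounded hemb hPhi hcl dV)
    (vartheta_moments_bounded hemb hPhi hcl dVU).
  apply/near0P; exists (Num.min r (Num.min rV rW)); first by rewrite !lt_min r0 rV0.
  move=> z; rewrite !lt_min => /and3P[zr zV zW].
  have [E kU] := hr z zr.
  rewrite /= (kappaE hemb hPhi hcl (hW z zW)) (kappaE hemb hPhi hcl (hV z zV)).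
  by rewrite (kappaE hemb hPhi hcl (hU _ kU)).
have hUV' : monotone_pair emb Phi (star U - 1) (star V).
  by have := monotone_pair_star hemb hPhi hUV; rewrite starD starN star1.
have [rU rU0 hU] := (near0P _).1 dU.
have [rV rV0 hV] := (near0P _).1 dV.
have [rW rW0 hW] := (near0P _).1 dUV.
have bW := varrho_moments_bounded hemb hPhi hcl dUV; rewrite starM in bW.
have [r r0 hr] := moment_kappa_composition hemb hPhi hcl rU0 hUV'
  (varrho_moments_bounded hemb hPhi hcl dU)
  (varrho_moments_bounded hemb hPhi hcl dV) bW.
apply/near0P; exists (Num.min r (Num.min rV rW)); first by rewrite !lt_min r0 rV0.
move=> z; rewrite !lt_min => /and3P[zr zV zW].
have zr' : nrm (star z) < r by rewrite nrm_star.
have [E kU] := hr _ zr'.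
rewrite /= (rhoE hemb hPhi hcl (hW z zW)) (rhoE hemb hPhi hcl (hV z zV)).
have kU' : nrm (star (moment_kappa emb Phi (star V) (star z))) < rU by rewrite nrm_star.
by rewrite (rhoE hemb hPhi hcl (hU _ kU')) starK (starM U V) E.
Qed.
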